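(* Let $\mathbb{S}^{2,4}=\{x\in\mathbb{R}^{3,4}: g(x,x)=1\}$ with the induced pseudo-Riemannian metric of signature $(2,4)$, and let $\omega(X,Y)=g(JX,Y)$ be the fundamental 2-form of the almost complex Cayley structure $J$ on $\mathbb{S}^{2,4}$. Then $\omega$ is an eigenform of the Laplace operator: $\Delta\omega=12\,\omega$.
   Context: The split Cayley algebra $\mathbf{Ca}'$ is the real vector space of elements $a+be$ with $a,b$ quaternions, with multiplication $(a+be)(c+de)=(ac+\overline d\,b)+(da+b\overline c)e$. With $e_1,e_2,e_3$ the standard quaternion units ($e_1e_2=e_3$), put $e_4=e$, $e_5=e_1e$, $e_6=e_2e$, $e_7=e_3e$. Conjugation is $\overline x=x_0-x_1e_1-\dots-x_7e_7$, and $\langle\cdot,\cdot\rangle$ is the scalar product with quadratic form $x\overline x=x_0^2+x_1^2+x_2^2+x_3^2-x_4^2-x_5^2-x_6^2-x_7^2$. The space $\mathbb{R}^{3,4}=\Im(\mathbf{Ca}')=\mathrm{span}(e_1,\dots,e_7)$ carries the restriction $g$ of $\langle\cdot,\cdot\rangle$, of signature $(3,4)$. The vector cross product is $X\times Y=\Im(XY)=XY+g(X,Y)$. With normal vector $\mathbf n(x)=x$, the almost complex Cayley structure is $J_x:T_x\mathbb{S}^{2,4}\to T_x\mathbb{S}^{2,4}$, $J_x(Y)=\mathbf n(x)\times Y$. The Laplacian on differential forms is $\Delta=d\delta+\delta d$, where on $k$-forms $\delta=(-1)^k\ast^{-1}d\,\ast=(-1)^{kn+n+1+\eta}\ast d\,\ast$,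 with $n=6$ the dimension, $\eta=4$ the number of minus signs of the metric, and $\ast$ the Hodge operator, $\alpha\wedge\ast\beta=g(\alpha,\beta)\mu_S$ for a metric volume form $\mu_S$ (so here $\delta=-\ast d\,\ast$). Exterior product and differential are taken without normalizing constants ($dx\wedge dy=dx\otimes dy-dy\otimes dx$). *)

(* Defs.v *)
From HB Require Import structures.
From mathcomp Require Import all_boot all_order all_algebra.
From mathcomp Require Import perm ring.
From mathcomp Require Import all_classical all_reals all_analysis.

Set Implicit Arguments.
Unset Strict Implicit.
Unset Printing Implicit Defensive.

Import Order.TTheory GRing.Theory Num.Theory.
Import numFieldNormedType.Exports.

Local Open Scope classical_set_scope.
Local Open Scope ring_scope.

Record quat (R : Type) := Quat { q0 : R; q1 : R; q2 : R; q3 : R }.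

Section Cayley.
Variable R : comNzRingType.

Definition addq (a b : quat R) : quat R :=
  Quat (q0 a + q0 b) (q1 a + q1 b) (q2 a + q2 b) (q3 a + q3 b).

Definition conjq (a : quat R) : quat R :=
  Quat (q0 a) (- q1 a) (- q2 a) (- q3 a).

Definition mulq (a b : quat R) : quat R :=
  Quat (q0 a * q0 b - q1 a * q1 b - q2 a * q2 b - q3 a * q3 b)
       (q0 a * q1 b + q1 a * q0 b + q2 a * q3 b - q3 a * q2 b)
       (q0 a * q2 b - q1 a * q3 b + q2 a * q0 b + q3 a * q1 b)
       (q0 a * q3 b + q1 a * q2 b - q2 a * q1 b + q3 a * q0 b).

(* The pair (a, b) stands for a + b e. *)
Definition cayley := (quat R * quat R)%type.

(* (a + b e)(c + d e) = (a c + conj d b) + (d a + b conj c) e *)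
Definition mulc (x y : cayley) : cayley :=
  let: (a, b) := x in let: (c, d) := y in
  (addq (mulq a c) (mulq (conjq d) b), addq (mulq d a) (mulq b (conjq c))).

Definition conjc (x : cayley) : cayley :=
  (conjq x.1, Quat (- q0 x.2) (- q1 x.2) (- q2 x.2) (- q3 x.2)).

(* The row vector X : 'rV_7 is the imaginary element X_1 e_1 + ... + X_7 e_7;
   the coordinate along e_i is X 0 (i - 1), as indices start from 0. *)
Definition imc (X : 'rV[R]_7) : cayley :=
  (Quat 0 (X 0 0) (X 0 1) (X 0 2), Quat (X 0 3) (X 0 4) (X 0 5) (X 0 6)).

Definition Imc (x : cayley) : 'rV[R]_7 :=
  let: (a, b) := x in
  \row_(i < 7) [:: q1 a; q2 a; q3 a; q0 b; q1 b; q2 b; q3 b]`_i.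

Definition cross (X Y : 'rV[R]_7) : 'rV[R]_7 := Imc (mulc (imc X) (imc Y)).

(* The Gram matrix of the scalar product on span(e_1, ..., e_7). *)
Definition g34 : 'M[R]_7 :=
  diag_mx (\row_(i < 7) (if (i < 3)%N then 1 else - 1)).

Definition g (X Y : 'rV[R]_7) : R := (X *m g34 *m Y^T) 0 0.

Lemma mulc_conjc (X : 'rV[R]_7) :
  mulc (imc X) (conjc (imc X)) = (Quat (g X X) 0 0 0, Quat 0 0 0 0).
Proof.
have -> : g X X = X 0 0 ^+ 2 + X 0 1 ^+ 2 + X 0 2 ^+ 2
                - X 0 3 ^+ 2 - X 0 4 ^+ 2 - X 0 5 ^+ 2 - X 0 6 ^+ 2.
  have e (i j : 'I_7) : val i = val j -> X 0 i = X 0 j by move/val_inj->.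
  rewrite /g /g34 mul_mx_diag mxE !big_ord_recl big_ord0 !mxE /=.
  rewrite (e ord0 0) // (e (lift ord0 ord0) 1) //.
  rewrite (e (lift ord0 (lift ord0 ord0)) 2) //.
  rewrite (e (lift ord0 (lift ord0 (lift ord0 ord0))) 3) //.
  rewrite (e (lift ord0 (lift ord0 (lift ord0 (lift ord0 ord0)))) 4) //.
  rewrite (e (lift ord0 (lift ord0 (lift ord0 (lift ord0 (lift ord0 ord0))))) 5) //.
  rewrite (e (lift ord0 (lift ord0 (lift ord0 (lift ord0 (lift ord0 (lift ord0 ord0)))))) 6) //.
  by ring.
by rewrite /mulc /imc /conjc /addq /mulq /conjq /=; congr (Quat _ _ _ _, Quat _ _ _ _); ring.
Qed.

End Cayley.

(* A k-tuple of vectors of R^n is a k x n matrix, whose rows are the vectors. *)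
Definition form (R : Type) (n k : nat) := 'M[R]_(k, n) -> R.

Section AlternatingForms.
Variable R : realType.

Definition alternating n k (a : form R n k) : Prop :=
  (forall (i : 'I_k) (b c : R) (A B C : 'M[R]_(k, n)),
      row i A = b *: row i B + c *: row i C ->
      row' i B = row' i A -> row' i C = row' i A ->
      a A = b * a B + c * a C) /\
  (forall (i j : 'I_k) (A : 'M[R]_(k, n)),
      i != j -> row i A = row j A -> a A = 0).

(* Normalized so that dx /\ dy = dx (x) dy - dy (x) dx. *)
Definition wedge n k l (a : form R n k) (b : form R n l) : form R n (k + l) :=
  fun V => (k`! * l`!)%:R^-1 *
    \sum_(s : 'S_(k + l))
      (-1) ^+ s * (a (usubmx (row_perm s V)) * b (dsubmx (row_perm s V))).

(* In index notation 1/k! g^{i_1 j_1} ... g^{i_k j_k} a_{i_1...i_k}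
   b_{j_1...j_k}: the forms dx^{i_1} /\ ... /\ dx^{i_k} with i_1 < ... < i_k
   are orthonormal, up to sign, when the dx^i are. *)
Definition inner_form n k (G : 'M[R]_n) (a b : form R n k) : R :=
  k`!%:R^-1 *
    \sum_(f : {ffun 'I_k -> 'I_n}) a (rowsub f 1%:M) * b (rowsub f (invmx G)).

(* sqrt |det G| dx^1 /\ ... /\ dx^n.  [conform_mx] turns the m x n matrix V into
   a square one when m = n, which is the only case in use. *)
Definition volume n m (G : 'M[R]_n) : form R n m :=
  fun V => Num.sqrt `|\det G| * \det (conform_mx (0 : 'M[R]_n) V).

(* c = *b, where k + l = n. *)
Definition is_hodge n k l (G : 'M[R]_n) (b : form R n k) (c : form R n l) :
    Prop :=
  alternating c /\
  forall a : form R n k, alternating a ->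
    forall V, wedge a c V = inner_form G a b * volume G V.

Definition hodge n k l (G : 'M[R]_n) (b : form R n k) : form R n l :=
  xget ((fun=> 0) : form R n l) [set c | is_hodge G b c].

End AlternatingForms.

Arguments hodge {R n k} l G b _.

Section Calculus.
Variables (R : realType) (n : nat).

Definition dform (k : nat) := 'rV[R]_n -> form R n k.

Definition extd k (a : dform k) : dform k.+1 := fun u V =>
  \sum_(i < k.+1) (-1) ^+ i * 'D_(row i V) (fun x => a x (row' i V)) u.

(* The field of Gram matrices of a pseudo-Riemannian metric in the coordinate
   frame, and the number of minus signs in its signature. *)
Variables (G : 'rV[R]_n -> 'M[R]_n) (eta : nat).

Definition star k l (a : dform k) : dform l := fun u => hodge l (G u) (a u).

Arguments star {k} l a _ _.

(* (-1)^(k n + n + 1 + eta) * d * on forms of degree k = k'+1.  It involves two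
   Hodge operators, hence does not depend on the orientation. *)
Definition codiff k' (a : dform k'.+1) : dform k' := fun u V =>
  (-1) ^+ (k'.+1 * n + n + 1 + eta)%N *
  star k' (extd (star (n - k'.+1) a)) u V.

Definition laplacian k' (a : dform k'.+1) : dform k'.+1 := fun u V =>
  extd (codiff a) u V + codiff (extd a) u V.

End Calculus.

Section Sphere.
Variable R : realType.

Definition S24 : set 'rV[R]_7 := [set x | g x x = 1].

Definition tangent (x v : 'rV[R]_7) : Prop := g x v = 0.

(* A k-form on S^{2,4}; only its values at points of S^{2,4}, on tangent
   vectors, are meaningful. *)
Definition sform (k : nat) := 'rV[R]_7 -> form R 7 k.

Definition J (x Y : 'rV[R]_7) : 'rV[R]_7 := cross x Y.

Definition omega : sform 2 := fun x V => g (J x (row 0 V)) (row 1 V).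

Fixpoint Cn (m : nat) (U : set 'rV[R]_6) (f : 'rV[R]_6 -> 'rV[R]_7) : Prop :=
  match m with
  | 0 => forall u, U u -> {for u, continuous f}
  | m'.+1 => (forall u, U u -> differentiable f u) /\
             (forall v, Cn m' U ('D_v f))
  end.

(* Smooth local parametrizations, i.e. inverses of local charts. *)
Definition parametrization (U : set 'rV[R]_6) (phi : 'rV[R]_6 -> 'rV[R]_7) :
    Prop :=
  [/\ open U,
      forall m, Cn m U phi,
      forall u, U u -> S24 (phi u),
      (forall u v, U u -> U v -> phi u = phi v -> u = v) &
      forall u, U u -> row_free ('J phi u)].

(* ['J phi u] acts on row vectors from the right: dphi_u(v) = v *m 'J phi u. *)
Definition pullback k (phi : 'rV[R]_6 -> 'rV[R]_7) (a : sform k) :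
    dform R 6 k :=
  fun u V => a (phi u) (V *m 'J phi u).

Definition induced_metric (phi : 'rV[R]_6 -> 'rV[R]_7) (u : 'rV[R]_6) :
    'M[R]_6 :=
  'J phi u *m g34 R *m ('J phi u)^T.

(* The equation Delta a = b on S^{2,4}, read in every local parametrization;
   the induced metric has signature (2,4), whence eta = 4. *)
Definition laplacian_on_S24 k' (a b : sform k'.+1) : Prop :=
  forall U phi, parametrization U phi ->
  forall u, U u -> forall V,
    laplacian (induced_metric phi) 4 (pullback phi a) u V = pullback phi b u V.

Definition eigenform k' (lambda : R) (a : sform k'.+1) : Prop :=
  (exists x V, [/\ S24 x, forall i, tangent x (row i V) & a x V != 0]) /\
  laplacian_on_S24 a (fun x V => lambda * a x V).

End Sphere.

(* Main.v *)
Require Import Defs.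
From mathcomp Require Import all_boot all_order all_algebra all_classical all_reals all_analysis.
From mathcomp Require Import perm ring.

Set Implicit Arguments.
Unset Strict Implicit.
Unset Printing Implicit Defensive.

Import Order.TTheory GRing.Theory Num.Theory.
Import numFieldNormedType.Exports.
Import Defs.

Local Open Scope classical_set_scope.
Local Open Scope ring_scope.

(** The fundamental form is the contraction of a constant 3-form A on R^7,
   namely A (X, Y, Z) = g (X x Y, Z), with the position vector x, which is also
   the unit normal of the sphere.  The equation Delta omega = 12 omega holds for
   the contraction of any constant 3-form, and this is what is proved
   ([laplacian_contraction]).

   Let B be the constant 4-form on R^7 that is Hodge dual to A.  For a linear
   hyperplane orthogonal to a unit vector x, the Hodge dual of the contraction of
   A with x is the restriction of B, the dual of the restriction of A is minus
   the contraction of B, and the dual of the restriction of B is the contraction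
   of A, all up to the sign eps that compares the orientation of the coordinates
   with the one induced by x ([hodge_contraction], [hodge_restriction3],
   [hodge_restriction4]).  On the other hand a constant form restricts to a
   closed form, and the contraction of a constant k-form with the position vector
   has differential k times the form ([extd_pullback_const],
   [extd_pullback_contraction]).  Hence omega is coclosed, as d of its dual is
   eps dB = 0, and
     d omega = 3 A,   * d omega = - 3 eps (x . B),   d * d omega = - 12 eps B,
     * d * d omega = - 12 omega,
   so that delta d omega = 12 omega; here eps is locally constant
   ([orientation_near]) and squares to 1.

   Two things make this work for the given definitions.  The Hodge operator is
   specified by a wedge product with all forms, so it is first computed on bases
   ([is_hodge_perm], [hodgeE]), where the passage from R^7 to a hyperplane amounts
   to adding x to the basis.  And the pulled back form depends on the point
   through the Jacobian too, so its differential contains second derivatives of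
   the parametrization; they cancel in pairs because they are symmetric
   ([derive_symmetric]) while the form is alternating
   ([alternating_sum_symmetric]). *)

(** * Multilinear forms *)

Section Multilinear.
Variable R : realType.

Definition multilinear n k (a : form R n k) : Prop :=
  forall (i : 'I_k) (b c : R) (A B C : 'M[R]_(k, n)),
    row i A = b *: row i B + c *: row i C ->
    row' i B = row' i A -> row' i C = row' i A ->
    a A = b * a B + c * a C.

Definition set_row n k (i : 'I_k) (v : 'rV[R]_n) (A : 'M[R]_(k, n)) :=
  \matrix_(j, c) (if j == i then v 0 c else A j c).

Lemma row_set_row n k (i : 'I_k) v (A : 'M[R]_(k, n)) : row i (set_row i v A) = v.
Proof. by apply/rowP => c; rewrite !mxE eqxx. Qed.

Lemma row_set_row_neq n k (i j : 'I_k) v (A : 'M[R]_(k, n)) :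
  j != i -> row j (set_row i v A) = row j A.
Proof. by move=> ji; apply/rowP => c; rewrite !mxE (negbTE ji). Qed.

Lemma row'_set_row n k (i : 'I_k) v (A : 'M[R]_(k, n)) :
  row' i (set_row i v A) = row' i A.
Proof. by apply/matrixP => j c; rewrite !mxE eq_sym (negbTE (neq_lift i j)). Qed.

Lemma set_row_id n k (i : 'I_k) (A : 'M[R]_(k, n)) : set_row i (row i A) A = A.
Proof. by apply/matrixP => j c; rewrite !mxE; case: eqP => [->|]. Qed.

Lemma multilinear_set_row n k (a : form R n k) i A : multilinear a ->
  forall b v w, a (set_row i (b *: v + w) A) = b * a (set_row i v A) + a (set_row i w A).
Proof.
move=> am b v w; rewrite -[a (set_row i w A)]mul1r; apply: (am i).
- by rewrite !row_set_row scale1r.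
- by rewrite !row'_set_row.
- by rewrite !row'_set_row.
Qed.

Lemma multilinear_row0 n k (a : form R n k) i A : multilinear a ->
  row i A = 0 -> a A = 0.
Proof.
move=> am r0; rewrite (am i 0 0 A A A) ?mul0r ?addr0 // r0.
by rewrite !scale0r addr0.
Qed.

Lemma multilinear_sum_row n k (a : form R n k) i A (I : Type) (r : seq I) (x : I -> R)
    (v : I -> 'rV[R]_n) : multilinear a ->
  a (set_row i (\sum_(j <- r) x j *: v j) A) = \sum_(j <- r) x j * a (set_row i (v j) A).
Proof.
move=> am; elim: r => [|j r IH].
  by rewrite !big_nil (multilinear_row0 (i := i)) // row_set_row.
by rewrite !big_cons multilinear_set_row // IH.
Qed.

Lemma eq_row'P n k (i : 'I_k) (A B : 'M[R]_(k, n)) :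
  row' i A = row' i B <-> forall j, j != i -> row j A = row j B.
Proof.
split=> [AB j|AB].
  rewrite eq_sym => /unlift_some[j' -> _]; apply/rowP => c.
  by have /matrixP/(_ j' c) := AB; rewrite !mxE.
apply/matrixP => j c; have ji : lift i j != i by rewrite eq_sym neq_lift.
by have /rowP/(_ c) := AB _ ji; rewrite !mxE.
Qed.

Lemma multilinear_col_mxd n k l (a : form R n (k + l)) Z : multilinear a ->
  multilinear (fun V : 'M[R]_(l, n) => a (col_mx Z V)).
Proof.
move=> am i b c A B C rA /eq_row'P rB /eq_row'P rC.
by apply: (am (rshift k i)); rewrite ?rowKd //; apply/eq_row'P => j;
  case: (split_ordP j) => j' -> ji; rewrite ?rowKu // !rowKd;
  [apply: rB|apply: rC]; apply: contraNneq ji => ->.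
Qed.

Lemma multilinear_col_mxu n k l (a : form R n (k + l)) Z : multilinear a ->
  multilinear (fun V : 'M[R]_(k, n) => a (col_mx V Z)).
Proof.
move=> am i b c A B C rA /eq_row'P rB /eq_row'P rC.
by apply: (am (lshift l i)); rewrite ?rowKu //; apply/eq_row'P => j;
  case: (split_ordP j) => j' -> ji; rewrite ?rowKd // !rowKu;
  [apply: rB|apply: rC]; apply: contraNneq ji => ->.
Qed.

(** Induction on the number of arguments: once the first row is expanded, the
   remaining arguments again enter multilinearly.  With a product as argument
   this is the change of frame formula, and with B = 1 the expansion in the
   standard basis. *)
Lemma multilinear_mulmx n m k (a : form R n k) (A : 'M[R]_(k, m)) (B : 'M[R]_(m, n)) :
  multilinear a ->
  a (A *m B) = \sum_(h : {ffun 'I_k -> 'I_m}) (\prod_i A i (h i)) * a (rowsub h B).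
Proof.
elim: k a A => [|k IH] a A am.
  have e0 : 'I_0 -> 'I_m by case.
  rewrite (big_pred1 [ffun i => e0 i]) => [|h]; last first.
    by apply/esym/eqP/ffunP; case.
  by rewrite big_ord0 mul1r; congr (a _); apply/matrixP; case.
pose a1 v : form R n k := fun V => a (col_mx v V : 'M[R]_(1 + k, n)).
have a1m v : multilinear (a1 v) by apply: (@multilinear_col_mxd _ 1).
pose A1 : 'M[R]_(k, m) := dsubmx (A : 'M[R]_(1 + k, m)).
have -> : a (A *m B) = \sum_j A 0 j * a1 (row j B) (A1 *m B).
  pose T : 'M[R]_(1 + k, n) := col_mx (row 0 A *m B) (A1 *m B).
  have -> : A *m B = T.
    rewrite /T -mul_col_mx; congr (_ *m _).
    apply/matrixP => i j; rewrite [RHS]mxE; case: splitP => p ip; rewrite !mxE; congr (A _ _).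
      by apply/val_inj; rewrite /= ip; case: p {ip} => [[]].
    by apply/val_inj.
  have -> : T = set_row 0 (\sum_j A 0 j *: row j B) T.
    rewrite -{1}(set_row_id 0 T); congr set_row.
    apply/rowP => c; rewrite !mxE.
    case: splitP => // p _; rewrite summxE (ord1 p) mxE.
    by apply: eq_bigr => j _; rewrite !mxE.
  rewrite multilinear_sum_row //; apply: eq_bigr => j _; congr (_ * a _).
  apply/matrixP => p q; rewrite [LHS]mxE /T [RHS]mxE; case: ifP => [/eqP ->|].
    by case: splitP => // p' _; rewrite (ord1 p').
  by rewrite mxE; case: splitP => // p' pp; rewrite -val_eqE /= pp (ord1 p').
under eq_bigr => j _ do rewrite (IH _ _ (a1m _)) mulr_sumr.
rewrite pair_bigA /=.
pose cons_fun (p : 'I_m * {ffun 'I_k -> 'I_m}) : {ffun 'I_k.+1 -> 'I_m} :=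
  [ffun i => if unlift ord0 i is Some i' then p.2 i' else p.1].
pose uncons_fun (h : {ffun 'I_k.+1 -> 'I_m}) := (h ord0, [ffun i => h (lift ord0 i)]).
rewrite [RHS](reindex cons_fun) /=; last first.
  exists uncons_fun => [[j h] _|h _].
    congr pair; first by rewrite ffunE unlift_none.
    by apply/ffunP => i; rewrite !ffunE liftK.
  apply/ffunP => i; rewrite ffunE; case: unliftP => [i' ->|->] //=.
  by rewrite ffunE.
apply: eq_bigr => -[j h] _ /=; rewrite big_ord_recl mulrA; congr (_ * _ * _).
- by rewrite ffunE unlift_none.
- apply: eq_bigr => i _; rewrite ffunE liftK mxE; congr (A _ _).
  exact/val_inj.
- congr (a _); apply/matrixP => p q; rewrite !mxE ffunE.
  case: unliftP => [p' ->|->].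
    by rewrite (_ : lift ord0 p' = rshift 1 p') ?(unsplitK (inr _)) ?mxE //; apply/val_inj.
  by rewrite (_ : ord0 = lshift k (0 : 'I_1)) ?(unsplitK (inl _)) ?mxE //; apply/val_inj.
Qed.

Lemma multilinear_expand n k (a : form R n k) (V : 'M[R]_(k, n)) : multilinear a ->
  a V = \sum_(h : {ffun 'I_k -> 'I_n}) (\prod_i V i (h i)) * a (rowsub h 1%:M).
Proof. by move=> am; rewrite -multilinear_mulmx // mulmx1. Qed.

End Multilinear.

(** * Alternating forms *)

Section Alternating.
Variable R : realType.

(** Polarization: a vanishes when rows i and j both equal v + w, and of the four
   terms of the expansion only the two with distinct rows survive. *)
Lemma alternating_tperm n k (a : form R n k) i j (V : 'M[R]_(k, n)) : alternating a ->
  i != j -> a (row_perm (tperm i j) V) = - a V.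
Proof.
move=> [am a0] ij; pose W u u' := set_row i u (set_row j u' V).
have ji : j != i by rewrite eq_sym.
have W0 u : a (W u u) = 0.
  by apply: (a0 i j) => //; rewrite row_set_row row_set_row_neq // row_set_row.
have WC u u' : W u u' = set_row j u' (set_row i u V).
  by apply/matrixP => p c; rewrite !mxE; case: eqP => // ->; rewrite (negbTE ij).
have addl v w u : a (W (v + w) u) = a (W v u) + a (W w u).
  by rewrite -[v]scale1r multilinear_set_row // scale1r mul1r.
have addr v w u : a (W u (v + w)) = a (W u v) + a (W u w).
  by rewrite WC -[v]scale1r multilinear_set_row // scale1r mul1r -!WC.
have := W0 (row i V + row j V); rewrite addl !addr !W0 add0r addr0.
have -> : W (row i V) (row j V) = V by rewrite /W !set_row_id.
have -> : W (row j V) (row i V) = row_perm (tperm i j) V.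
  apply/matrixP => p c; rewrite !mxE.
  by case: tpermP => [->|->|/eqP/negbTE -> /eqP/negbTE ->]; rewrite ?eqxx ?(negbTE ji).
by move=> /eqP; rewrite addrC addr_eq0 => /eqP.
Qed.

Lemma alternating_row_perm n k (a : form R n k) (s : 'S_k) (V : 'M[R]_(k, n)) :
  alternating a -> a (row_perm s V) = (-1) ^+ s * a V.
Proof.
move=> aa; have [ts -> tsP] := prod_tpermP s.
elim: ts tsP V => [_|t ts IH /= /andP[t12 /IH{}IH]] V.
  by rewrite big_nil odd_perm1 mul1r row_perm1.
rewrite big_cons odd_permM odd_tperm t12 row_permM alternating_tperm // IH.
by rewrite signr_addb mulN1r -mulNr.
Qed.

Lemma alternating_eq0 n m k (a : form R n k) (h : 'I_k -> 'I_m) (B : 'M[R]_(m, n)) :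
  alternating a -> ~~ injectiveb h -> a (rowsub h B) = 0.
Proof.
move=> [_ a0] /injectivePn[i [j ij hij]]; apply: (a0 i j) => //.
by apply/rowP => c; rewrite !mxE hij.
Qed.

Lemma alternating_rowsub_perm n m k (a : form R n k) (h : 'I_k -> 'I_m) (s : 'S_k)
    (B : 'M[R]_(m, n)) : alternating a ->
  a (rowsub (h \o s) B) = (-1) ^+ s * a (rowsub h B).
Proof.
by move=> aa; rewrite -alternating_row_perm //; congr (a _); apply/matrixP => i j; rewrite !mxE.
Qed.

(** When the determinant is expanded, each permutation contributes a (X *m M):
   reindexing h by the permutation yields its sign a second time, through a. *)
Lemma sum_det_colsub n m k (a : form R n k) (X : 'M[R]_(k, m)) (M : 'M[R]_(m, n)) :
  alternating a ->
  \sum_(h : {ffun 'I_k -> 'I_m}) \det (colsub h X) * a (rowsub h M) =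
  k`!%:R * a (X *m M).
Proof.
move=> aa; have [am _] := aa.
under eq_bigr => h _ do rewrite /determinant mulr_suml.
rewrite exchange_big /= (eq_bigr (fun=> a (X *m M))); last first.
  move=> s _; rewrite multilinear_mulmx //.
  rewrite [RHS](reindex (fun h : {ffun 'I_k -> 'I_m} => [ffun i => h (s i)])) /=; last first.
    exists (fun h : {ffun 'I_k -> 'I_m} => [ffun i => h (s^-1 i)])%g => h _;
      by apply/ffunP => i; rewrite !ffunE (permK, permKV).
  apply: eq_bigr => h _.
  rewrite mulrAC mulrC; congr (_ * _).
    by apply: eq_bigr => i _; rewrite mxE ffunE.
  rewrite -alternating_rowsub_perm //; congr (a _).
  by apply/matrixP => p q; rewrite !mxE ffunE.
by rewrite sumr_const mulr_natl -card_Sn.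
Qed.

Lemma alternating_col_mxd n k l (a : form R n (k + l)) Z : alternating a ->
  alternating (fun V : 'M[R]_(l, n) => a (col_mx Z V)).
Proof.
move=> [am a0]; split; first exact: multilinear_col_mxd.
move=> i j A ij rij; apply: (a0 (rshift k i) (rshift k j)).
  by apply: contra ij => /eqP/rshift_inj ->.
by rewrite !rowKd.
Qed.

Lemma alternating_col_mxu n k l (a : form R n (k + l)) Z : alternating a ->
  alternating (fun V : 'M[R]_(k, n) => a (col_mx V Z)).
Proof.
move=> [am a0]; split; first exact: multilinear_col_mxu.
move=> i j A ij rij; apply: (a0 (lshift l i) (lshift l j)).
  by apply: contra ij => /eqP/lshift_inj ->.
by rewrite !rowKu.
Qed.

Lemma alternating_det n : alternating (fun V : 'M[R]_n => \det V).
Proof.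
split=> [i b c A B C rA rB rC|i j A ij rij]; first exact: determinant_multilinear rA rB rC.
by apply: (determinant_alternate ij) => c; have /rowP/(_ c) := rij; rewrite !mxE.
Qed.

End Alternating.

(** * The exterior product in top degree *)

Section Wedge.
Variable R : realType.

Lemma multilinear_tensor n k l (a : form R n k) (c : form R n l) :
  multilinear a -> multilinear c ->
  multilinear (fun X : 'M[R]_(k + l, n) => a (usubmx X) * c (dsubmx X)).
Proof.
move=> am cm i x y A B C.
rewrite -[A]vsubmxK -[B]vsubmxK -[C]vsubmxK !col_mxKu !col_mxKd.
move: (usubmx A) (usubmx B) (usubmx C) (dsubmx A) (dsubmx B) (dsubmx C).
move=> {A B C} A1 B1 C1 A2 B2 C2.
case: (split_ordP i) => i' ->; rewrite ?rowKu ?rowKd => rA /eq_row'P rB /eq_row'P rC.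
  have E X1 X2 : (forall j, j != lshift l i' -> row j (col_mx X1 X2) = row j (col_mx A1 A2)) ->
     row' i' X1 = row' i' A1 /\ X2 = A2.
    move=> H; split.
      apply/eq_row'P => j ji; have := H (lshift l j); rewrite !rowKu; apply.
      by apply: contra ji => /eqP/lshift_inj ->.
    by apply/row_matrixP => j; have := H (rshift k j); rewrite !rowKd; apply; rewrite eq_rlshift.
  have [rB1 ->] := E _ _ rB; have [rC1 ->] := E _ _ rC.
  by rewrite (am _ _ _ _ _ _ rA rB1 rC1) mulrDl !mulrA.
have E X1 X2 : (forall j, j != rshift k i' -> row j (col_mx X1 X2) = row j (col_mx A1 A2)) ->
   row' i' X2 = row' i' A2 /\ X1 = A1.
  move=> H; split.
    apply/eq_row'P => j ji; have := H (rshift k j); rewrite !rowKd; apply.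
    by apply: contra ji => /eqP/rshift_inj ->.
  by apply/row_matrixP => j; have := H (lshift l j); rewrite !rowKu; apply; rewrite eq_lrshift.
have [rB1 ->] := E _ _ rB; have [rC1 ->] := E _ _ rC.
by rewrite (cm _ _ _ _ _ _ rA rB1 rC1) mulrDr mulrCA (mulrCA (a A1)).
Qed.

(** In the expansion of the arguments on the standard basis, the alternating sum
   over the permutations makes determinants det (colsub h V) out of the
   coefficients, and each of them is a multiple of det V. *)
Lemma wedge_topE k l (a : form R (k + l) k) (c : form R (k + l) l) V :
  multilinear a -> multilinear c ->
  wedge a c V = \det V * wedge a c 1%:M.
Proof.
move=> am cm; pose T (X : 'M[R]_(k + l, k + l)) := a (usubmx X) * c (dsubmx X).
have Tm : multilinear T by apply: multilinear_tensor.
have E X : \sum_(s : 'S_(k + l)) (-1) ^+ s * T (row_perm s X) =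
    \sum_(h : {ffun 'I_(k + l) -> 'I_(k + l)}) \det (colsub h X) * T (rowsub h 1%:M).
  under eq_bigr => s _ do rewrite (multilinear_expand _ Tm) mulr_sumr.
  rewrite exchange_big; apply: eq_bigr => h _ /=.
  rewrite -det_tr /determinant mulr_suml; apply: eq_bigr => s _.
  by rewrite mulrA; congr (_ * _ * _); apply: eq_bigr => i _; rewrite !mxE.
rewrite /wedge mulrCA; congr (_ * _); rewrite !E mulr_sumr; apply: eq_bigr => h _.
by rewrite [RHS]mulrA -det_mulmx mulmx_colsub mulmx1.
Qed.

(** List the image of i and then its complement, do the same for f, and send
   each entry of the first list to the entry of the second at the same place. *)
Lemma perm_extend n m (i f : 'I_m -> 'I_n) : injective i -> injective f ->
  exists s : 'S_n, forall x, s (i x) = f x.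
Proof.
move=> ii fi; pose ext (h : 'I_m -> 'I_n) := codom h ++ [seq y <- enum 'I_n | y \notin codom h].
have extP h : injective h -> perm_eq (ext h) (enum 'I_n).
  move=> hi; rewrite perm_sym -(perm_filterC (mem (codom h)) (enum _)).
  rewrite perm_cat2r; apply: uniq_perm.
  - by rewrite filter_uniq // enum_uniq.
  - exact/injectiveP.
  - by move=> y; rewrite mem_filter mem_enum andbT.
have szE h : injective h -> size (ext h) = n by move/extP/perm_size ->; rewrite size_enum_ord.
have uE h : injective h -> uniq (ext h) by move/extP/perm_uniq ->; rewrite enum_uniq.
have mE h : injective h -> forall y, y \in ext h.
  by move=> /extP/perm_mem hE y; rewrite hE mem_enum.
pose e (y : 'I_n) := nth y (ext f) (index y (ext i)).
have ltE y : (index y (ext i) < size (ext f))%N.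
  by rewrite (szE f fi) -[ltnRHS](szE i ii) index_mem mE.
have ei : injective e.
  move=> y z; rewrite /e (set_nth_default y z) // => /eqP.
  rewrite nth_uniq ?uE // => /eqP eqi.
  by rewrite -(nth_index y (mE _ ii y)) eqi nth_index ?mE.
exists (perm ei) => x; rewrite permE /e.
have -> : index (i x) (ext i) = x.
  rewrite index_cat codom_f codomE index_map // index_enum_ord.
  by [].
by rewrite nth_cat size_codom card_ord ltn_ord codomE (nth_map x) ?size_enum_ord // nth_ord_enum.
Qed.

(** The permutations that extend a given injection form a coset of the group of
   those that fix the image of i pointwise, which has order (n - m)!. *)
Lemma sum_perm_comp n m (i : 'I_m -> 'I_n) (F : {ffun 'I_m -> 'I_n} -> R) :
  injective i -> (forall f : {ffun _ -> _}, ~~ injectiveb f -> F f = 0) ->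
  \sum_(s : 'S_n) F [ffun x => s (i x)] = (n - m)`!%:R * \sum_f F f.
Proof.
move=> ii F0.
rewrite (partition_big (fun s : 'S_n => [ffun x => s (i x)]) predT) //= mulr_sumr.
apply: eq_bigr => f _; have [/injectiveP fi|nfi] := boolP (injectiveb f); last first.
  by rewrite F0 // mulr0 big1 // => s /eqP ->; rewrite F0.
rewrite (eq_bigr (fun=> F f)) => [|s /eqP -> //].
rewrite sumr_const mulr_natl; congr (_ *+ _).
have [s0 s0E] := perm_extend ii fi.
pose S := ~: [set i x | x in 'I_m].
have <- : #|S| = (n - m)%N.
  by rewrite cardsCs finset.setCK card_ord card_imset // card_ord.
rewrite -(card_perm S) -(card_imset (perm_on S) (mulIg s0)); apply: eq_card => s.
transitivity ([ffun x => s (i x)] == f); first by [].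
apply/eqP/imsetP => [sf|[t tS ->]].
  exists (s * s0^-1)%g; last by apply/permP => y; rewrite !permM permKV.
  rewrite unfold_in; apply/fintype.subsetP => y; rewrite unfold_in permM => ny; rewrite inE.
  apply: contra ny => /imsetP[x _ ->]; have /ffunP/(_ x) := sf.
  by rewrite ffunE => ->; rewrite -s0E permK.
apply/ffunP => x; rewrite ffunE permM (out_perm tS) ?s0E //.
by rewrite inE negbK imset_f.
Qed.

Lemma wedge1 k l (a : form R (k + l) k) (c : form R (k + l) l) :
  wedge a c 1%:M = (k`! * l`!)%:R^-1 * \sum_(s : 'S_(k + l))
    (-1) ^+ s * (a (rowsub (s \o lshift l) 1%:M) * c (rowsub (s \o @rshift k l) 1%:M)).
Proof.
congr (_ * _); apply: eq_bigr => s _; congr (_ * (a _ * c _));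
  by apply/matrixP => i j; rewrite !mxE.
Qed.

End Wedge.

(** * The Hodge operator in a basis *)

Section Hodge.
Variable R : realType.

(** The Hodge dual can be checked on the reorderings of the standard basis: the
   wedge product at the identity is an alternating sum over these, the two signs
   cancel, and grouping the permutations by their effect on the first k indices
   gives the sum over index maps that defines the inner product. *)
Lemma is_hodge_perm k l (G : 'M[R]_(k + l)) (b : form R (k + l) k)
    (c : form R (k + l) l) : alternating c ->
  (forall s : 'S_(k + l), c (rowsub (s \o @rshift k l) 1%:M) =
     (-1) ^+ s * (Num.sqrt `|\det G| * b (rowsub (s \o lshift l) (invmx G)))) ->
  is_hodge G b c.
Proof.
move=> ca cE; split=> // a aa V.
rewrite wedge_topE ?wedge1 /volume ?conform_mx_id; [|exact: proj1 aa|exact: proj1 ca].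
rewrite mulrC (mulrA _ _ (\det V)); congr (_ * _).
pose F (f : {ffun 'I_k -> 'I_(k + l)}) := a (rowsub f 1%:M) * b (rowsub f (invmx G)).
rewrite (eq_bigr (fun s : 'S_(k + l) => Num.sqrt `|\det G| * F [ffun x => s (lshift l x)])); last first.
  move=> s _; rewrite cE.
  have -> : F [ffun x => s (lshift l x)] =
      a (rowsub (s \o lshift l) 1%:M) * b (rowsub (s \o lshift l) (invmx G)).
    by congr (a _ * b _); apply/matrixP => i j; rewrite !mxE ffunE.
  rewrite mulrCA [X in _ * X]mulrA -expr2 sqrr_sign mul1r mulrCA.
  by [].
rewrite -mulr_sumr sum_perm_comp; [|exact: lshift_inj|]; last first.
  by move=> f nf; rewrite /F alternating_eq0 // mul0r.
rewrite /inner_form addKn natrM invfM mulrCA mulrC mulrA -!mulrA mulKf //.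
Qed.

(** The Hodge dual is unique because its wedge products with the alternating
   forms X |-> det (X, Z) recover all of its values. *)
Lemma wedge_det_col_mx k l (c : form R (k + l) l) Z : alternating c ->
  wedge (fun X : 'M[R]_(k, k + l) => \det (col_mx X Z)) c 1%:M = c Z.
Proof.
move=> ca; rewrite wedge1.
pose F (f : {ffun 'I_l -> 'I_(k + l)}) := \det (colsub f Z) * c (rowsub f 1%:M).
rewrite (eq_bigr (fun s : 'S_(k + l) => F [ffun x => s (rshift k x)])); last first.
  move=> s _; rewrite mulrA; congr (_ * c _); last first.
    by apply/matrixP => i j; rewrite !mxE ffunE.
  set X := col_mx _ _.
  have -> : (-1) ^+ s * \det X = \det (col_perm s X).
    by rewrite col_permE det_mulmx det_perm odd_permV mulrC.
  have -> : col_perm s X = block_mx 1%:M 0 (colsub (s \o lshift l) Z) (colsub (s \o @rshift k l) Z).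
    apply/matrixP => i j; rewrite mxE; case: (split_ordP i) => i' ->; case: (split_ordP j) => j' ->;
      rewrite ?col_mxEu ?col_mxEd !mxE ?(unsplitK (inl _)) ?(unsplitK (inr _)) ?mxE //=.
      by rewrite (inj_eq perm_inj) (inj_eq (@lshift_inj _ _)).
    by rewrite (inj_eq perm_inj) eq_lrshift.
  rewrite det_lblock det1 mul1r; congr (\det _).
  by apply/matrixP => i j; rewrite !mxE ffunE.
rewrite sum_perm_comp; [|exact: rshift_inj|]; last first.
  by move=> f nf; rewrite /F alternating_eq0 // mulr0.
rewrite addnK sum_det_colsub // mulmx1 (mulrA k`!%:R) -natrM mulKf //.
Qed.

Lemma is_hodge_unique k l (G : 'M[R]_(k + l)) (b : form R (k + l) k)
    (c c' : form R (k + l) l) : is_hodge G b c -> is_hodge G b c' -> c = c'.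
Proof.
move=> [ca cP] [ca' cP']; apply/funext => Z.
have aa := alternating_col_mxu Z (@alternating_det R (k + l)).
by rewrite -(wedge_det_col_mx Z ca) -(wedge_det_col_mx Z ca') cP // cP'.
Qed.

Lemma hodgeE k l (G : 'M[R]_(k + l)) (b : form R (k + l) k)
    (c : form R (k + l) l) : is_hodge G b c -> hodge l G b = c.
Proof. by move=> bc; apply: xget_unique => // c' /is_hodge_unique; apply. Qed.

Lemma alternatingZ n k t (a : form R n k) :
  alternating a -> alternating (fun V => t * a V).
Proof.
move=> [am a0]; split=> [i b c A B C rA rB rC|i j A ij rij].
  by rewrite (am _ _ _ _ _ _ rA rB rC) mulrDr; congr (_ + _); rewrite mulrCA.
by rewrite (a0 _ _ _ ij rij) mulr0.
Qed.

Lemma is_hodgeZ k l (G : 'M[R]_(k + l)) t (b : form R (k + l) k)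
    (c : form R (k + l) l) : is_hodge G b c ->
  is_hodge G (fun V => t * b V) (fun V => t * c V).
Proof.
move=> [ca cP]; split=> [|a aa V]; first exact: alternatingZ.
have -> : inner_form G a (fun V => t * b V) = t * inner_form G a b.
  rewrite /inner_form [RHS]mulrCA; congr (_ * _); rewrite mulr_sumr.
  by apply: eq_bigr => f _; rewrite mulrCA.
rewrite -mulrA -cP // /wedge [RHS]mulrCA; congr (_ * _); rewrite mulr_sumr.
by apply: eq_bigr => s _; rewrite (mulrCA t) (mulrCA t).
Qed.

(** The Hodge dual of b when |det G| = 1: the determinant contracted with b, the
   indices being raised by the inverse Gram matrix. *)
Definition flat_star k l (G : 'M[R]_(k + l)) (b : form R (k + l) k) : form R (k + l) l :=
  fun Y => k`!%:R^-1 * \sum_(h : {ffun 'I_k -> 'I_(k + l)})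
    b (rowsub h (invmx G)) * \det (col_mx (rowsub h 1%:M) Y).

Lemma alternating_flat_star k l (G : 'M[R]_(k + l)) (b : form R (k + l) k) :
  alternating (flat_star G b).
Proof.
have da Z := alternating_col_mxd Z (@alternating_det R (k + l)).
apply: alternatingZ; split=> [i x y A B C rA rB rC|i j A ij rij].
  rewrite !mulr_sumr -big_split; apply: eq_bigr => h _ /=.
  by rewrite ((da _).1 _ _ _ _ _ _ rA rB rC) mulrDr; congr (_ + _); rewrite mulrCA.
by rewrite big1 // => h _; rewrite ((da _).2 _ _ _ ij rij) mulr0.
Qed.

(** Expanding d on the standard basis and collecting the coefficients with
   [multilinear_mulmx] moves W from d to b.  Since W^T *m M is the same for all
   pairs of dual frames, so is the contraction of two forms. *)
Lemma sum_frame n m k (b d : form R n k) (M W : 'M[R]_(m, n)) :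
  multilinear b -> multilinear d ->
  \sum_(h : {ffun 'I_k -> 'I_m}) b (rowsub h M) * d (rowsub h W) =
  \sum_(h : {ffun 'I_k -> 'I_n}) b (rowsub h (W^T *m M)) * d (rowsub h 1%:M).
Proof.
move=> bm dm.
under eq_bigr => h _ do rewrite (multilinear_expand _ dm) mulr_sumr.
rewrite exchange_big; apply: eq_bigr => h _ /=.
have -> : rowsub h (W^T *m M) = rowsub h W^T *m M by rewrite mul_rowsub_mx.
rewrite multilinear_mulmx // mulr_suml; apply: eq_bigr => f _.
by rewrite mulrCA mulrA; congr (_ * _ * _); apply: eq_bigr => i _; rewrite !mxE.
Qed.

(** The contraction is computed in the frame W and its G-dual M.  The last l rows
   of W already occur in the determinant, so only the index maps into the first k
   rows remain, and they all contribute the same amount. *)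
Lemma flat_star_frame k l (G : 'M[R]_(k + l)) (b : form R (k + l) k) (M W : 'M[R]_(k + l)) :
  alternating b -> M *m G *m W^T = 1%:M ->
  flat_star G b (dsubmx W) = \det W * b (usubmx M).
Proof.
move=> ba MGW.
have WM : W^T *m M = invmx G.
  have GWM : G *m (W^T *m M) = 1%:M by rewrite mulmxA; apply: mulmx1C; rewrite mulmxA.
  have [Gu _] := mulmx1_unit GWM.
  by rewrite -[LHS](mulKmx Gu) GWM mulmx1.
have da := alternating_col_mxu (dsubmx W) (@alternating_det R (k + l)).
rewrite /flat_star -WM -(sum_frame M W ba.1 da.1).
rewrite (eq_bigr (fun h : {ffun 'I_k -> 'I_(k + l)} => \det W * (\det (colsub h (usubmx 1%:M)) * b (rowsub h M)))); last first.
  move=> h _; rewrite mulrCA [LHS]mulrC mulrA; congr (_ * _).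
  have -> : col_mx (rowsub h W) (dsubmx W) = col_mx (rowsub h 1%:M) (dsubmx 1%:M) *m W.
    by rewrite mul_col_mx mul_dsub_mx mul_rowsub_mx !mul1mx.
  rewrite det_mulmx; congr (_ * _).
  have -> : col_mx (rowsub h 1%:M) (dsubmx 1%:M) =
     block_mx (colsub h (usubmx 1%:M))^T (rsubmx (rowsub h 1%:M)) 0 1%:M :> 'M[R]_(k + l).
    apply/matrixP => i j; case: (split_ordP i) => i' ->; case: (split_ordP j) => j' ->;
      rewrite ?col_mxEu ?col_mxEd !mxE ?(unsplitK (inl _)) ?(unsplitK (inr _)) ?mxE //=.
    - by rewrite eq_sym.
    - by rewrite eq_rlshift.
    - by rewrite (inj_eq (@rshift_inj _ _)).
  by rewrite det_ublock det1 mulr1 det_tr.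
rewrite -mulr_sumr sum_det_colsub // mulrCA mulKf.
  by rewrite mul_usub_mx mul1mx.
by rewrite pnatr_eq0 -lt0n fact_gt0.
Qed.

End Hodge.

(** * Hodge duals on a unit normal hyperplane *)

Section Frame.
Variable R : realType.

Lemma alternating_mulmx n m k (a : form R n k) (P : 'M[R]_(m, n)) : alternating a ->
  alternating (fun V : 'M[R]_(k, m) => a (V *m P)).
Proof.
move=> [am a0]; split=> [i b c A B C rA /eq_row'P rB /eq_row'P rC|i j A ij rij].
  apply: (am i).
  - by rewrite !row_mul rA mulmxDl !scalemxAl.
  - by apply/eq_row'P => j ji; rewrite !row_mul rB.
  - by apply/eq_row'P => j ji; rewrite !row_mul rC.
by apply: (a0 i j) => //; rewrite !row_mul rij.
Qed.

Variables (n : nat) (S : 'M[R]_(1 + n)) (x : 'rV[R]_(1 + n)) (P : 'M[R]_(n, 1 + n)).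
Hypothesis S_sym : S^T = S.
Hypothesis x_unit : x *m S *m x^T = 1%:M.
Hypothesis P_tangent : P *m S *m x^T = 0.
Hypothesis P_free : row_free P.

Let G := P *m S *m P^T.
Let Q : 'M[R]_(1 + n) := col_mx x P.

Let xSP : x *m S *m P^T = 0.
Proof. by apply: trmx_inj; rewrite !trmx_mul trmxK S_sym mulmxA P_tangent trmx0. Qed.

Lemma gram_adapted : Q *m S *m Q^T = block_mx 1%:M 0 0 G.
Proof. by rewrite tr_col_mx !mul_col_mx !mul_mx_row x_unit P_tangent xSP. Qed.

Lemma adapted_unitmx : Q \in unitmx.
Proof.
rewrite -row_free_unit; apply: inj_row_free => v.
rewrite -[v]hsubmxK mul_row_col => v0.
have v1 : lsubmx v = 0.
  have := congr1 (fun w => w *m S *m x^T) v0.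
  by rewrite !mulmxDl -!mulmxA (mulmxA x) x_unit (mulmxA P) P_tangent mulmx0 addr0 mulmx1 mul0mx.
move: v0; rewrite v1 mul0mx add0r -[RHS](mul0mx _ P) => /(row_free_inj P_free) ->.
by rewrite row_mx0.
Qed.

Lemma det_gram_adapted : \det G = \det Q ^+ 2 * \det S.
Proof.
have := congr1 determinant gram_adapted.
by rewrite !det_mulmx det_tr det_lblock det1 mul1r => <-; rewrite mulrAC.
Qed.

(** In a basis that consists of a unit normal x and of tangent vectors, x is dual
   to itself, and the tangent vectors have their dual basis in the hyperplane. *)
Lemma adapted_dual_frame (s : 'S_n) : \det S = 1 ->
  col_mx x (row_perm s (invmx G *m P)) *m S *m (col_mx x (row_perm s P))^T = 1%:M.
Proof.
move=> S1; have Gu : G \in unitmx.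
  rewrite unitmxE det_gram_adapted S1 mulr1 unitfE expf_eq0 /= -unitfE -unitmxE.
  exact: adapted_unitmx.
pose L : 'M[R]_(1 + n) := block_mx 1%:M 0 0 (perm_mx s).
have LT : L *m L^T = 1%:M.
  rewrite tr_block_mx !trmx0 mulmx_block !mul0mx !mulmx0 !addr0 !add0r trmx1 mulmx1.
  by rewrite tr_perm_mx -perm_mxM mulgV perm_mx1 -scalar_mx_block.
have -> : col_mx x (row_perm s P) = L *m Q.
  by rewrite mul_block_col !mul0mx mul1mx addr0 add0r row_permE.
have -> : col_mx x (row_perm s (invmx G *m P)) = L *m block_mx 1%:M 0 0 (invmx G) *m Q.
  rewrite -mulmxA !mul_block_col !mul0mx !mul1mx !addr0 !add0r; congr col_mx.
  by rewrite row_permE.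
clearbody L; set B := block_mx _ _ _ _.
have -> : L *m B *m Q *m S *m (L *m Q)^T = L *m (B *m (Q *m S *m Q^T)) *m L^T.
  by rewrite trmx_mul !mulmxA.
rewrite gram_adapted mulmx_block !mul0mx !mulmx0 !mul1mx !addr0 !add0r mulVmx //.
by rewrite -scalar_mx_block mulmx1.
Qed.

Lemma det_col_mx_row_perm (s : 'S_n) : \det (col_mx x (row_perm s P)) = (-1) ^+ s * \det Q.
Proof.
have -> : col_mx x (row_perm s P) = block_mx 1%:M 0 0 (perm_mx s) *m Q.
  by rewrite mul_block_col !mul0mx mul1mx addr0 add0r row_permE.
by rewrite det_mulmx det_lblock det1 mul1r det_perm.
Qed.

End Frame.

Section DualPair.
Variable R : realType.

(** B is Hodge dual to A, up to the volume factor sqrt |det S|.  Stating this on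
   all pairs of S-dual bases leaves the choice of a basis through the normal
   vector to each application. *)
Definition star_pair k l (S : 'M[R]_(k + l)) (A : form R (k + l) k)
    (B : form R (k + l) l) : Prop :=
  forall M W : 'M[R]_(k + l), M *m S *m W^T = 1%:M ->
  B (dsubmx W) = \det W * A (usubmx M).

Lemma star_pair_flat_star k l (S : 'M[R]_(k + l)) (A : form R (k + l) k) :
  alternating A -> star_pair S A (flat_star S A).
Proof. by move=> Aa M W; apply: flat_star_frame. Qed.

(** Dual bases stay dual when both are permuted in the same way. *)
Lemma star_pair_perm k l (S : 'M[R]_(k + l)) (A : form R (k + l) k)
    (B : form R (k + l) l) (t : 'S_(k + l)) (M W : 'M[R]_(k + l)) :
  star_pair S A B -> M *m S *m W^T = 1%:M ->
  B (rowsub (t \o @rshift k l) W) = (-1) ^+ t * \det W * A (rowsub (t \o lshift l) M).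
Proof.
move=> AB MW.
have E : row_perm t M *m S *m (row_perm t W)^T = 1%:M.
  rewrite !row_permE trmx_mul.
  have -> : perm_mx t *m M *m S *m (W^T *m (perm_mx t)^T) =
     perm_mx t *m (M *m S *m W^T) *m (perm_mx t)^T by rewrite !mulmxA.
  by rewrite MW mulmx1 tr_perm_mx -perm_mxM mulgV perm_mx1.
have := AB _ _ E; rewrite [in \det _]row_permE det_mulmx det_perm.
have -> : dsubmx (row_perm t W) = rowsub (t \o @rshift k l) W.
  by apply/matrixP => i j; rewrite !mxE.
have -> // : usubmx (row_perm t M) = rowsub (t \o lshift l) M.
by apply/matrixP => i j; rewrite !mxE.
Qed.

(** Adding 4 modulo 7 takes the first three places to the last three, and the last
   four places to the first four. *)
Let rot7 : 'S_7 := perm (@addIr 'I_7 (inord 4)).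

(** A permutation of odd order is even. *)
Let rot7_even : (rot7 : bool) = false.
Proof.
have : (rot7 ^+ 7)%g = 1%g.
  apply/permP => i; rewrite permX /= !permE -!addrA.
  rewrite -[RHS]addr0; congr (_ + _); apply/val_inj => /=.
  by rewrite !inordK.
move/(congr1 (@odd_perm _)); rewrite odd_perm1 !expgS expg0 mulg1 !odd_permM.
by case: odd_perm.
Qed.

(** The star is an involution here: moving a block of 3 vectors past a block of 4
   is an even permutation, and S has determinant 1. *)
Lemma star_pair_sym (S : 'M[R]_7) (A : form R 7 3) (B : form R 7 4) :
  S^T = S -> \det S = 1 ->
  star_pair (k := 3) (l := 4) S A B -> star_pair (k := 4) (l := 3) S B A.
Proof.
move=> S_sym S_det AB M W MW.
have WM : W *m S *m M^T = 1%:M.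
  by apply: trmx_inj; rewrite !trmx_mul trmxK S_sym mulmxA MW trmx1.
have := star_pair_perm (k := 3) (l := 4) rot7 AB WM.
rewrite rot7_even mul1r.
have -> : rowsub (rot7 \o @rshift 3 4) M = usubmx (M : 'M[R]_(4 + 3, 7)).
  apply/matrixP => i j; rewrite !mxE; congr (M _ _); apply/val_inj => /=.
  rewrite permE /= inordK // -addnA.
  by case: i => -[|[|[|[|]]]].
have -> : rowsub (rot7 \o @lshift 3 4) W = dsubmx (W : 'M[R]_(4 + 3, 7)).
  apply/matrixP => i j; rewrite !mxE; congr (W _ _); apply/val_inj => /=.
  rewrite permE /= inordK //.
  by case: i => -[|[|[|]]].
move=> ->; rewrite mulrA; have := congr1 determinant MW.
by rewrite !det_mulmx S_det mulr1 det_tr det1 (mulrC (\det W)) => ->; rewrite mul1r.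
Qed.

End DualPair.

Section Sphere.
Variables (R : realType) (S : 'M[R]_7) (x : 'rV[R]_7) (P : 'M[R]_(6, 7)).
Hypothesis S_sym : S^T = S.
Hypothesis S_det : \det S = 1.
Hypothesis x_unit : x *m S *m x^T = 1%:M.
Hypothesis P_tangent : P *m S *m x^T = 0.
Hypothesis P_free : row_free P.

Let G := P *m S *m P^T.
Let D : R := \det (col_mx x P : 'M[R]_(1 + 6)).
Let eps := Num.sg D.

Let G_eps : Num.sqrt `|\det G| = eps * D.
Proof.
rewrite (det_gram_adapted S_sym x_unit P_tangent) S_det mulr1 ger0_norm ?sqr_ge0 //.
by rewrite sqrtr_sqr normrEsg.
Qed.

Let W (s : 'S_6) : 'M[R]_7 := col_mx x (row_perm s P).
Let M (s : 'S_6) : 'M[R]_7 := col_mx x (row_perm s (invmx G *m P)).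

Let MW s : M s *m S *m (W s)^T = 1%:M.
Proof. exact: (adapted_dual_frame S_sym x_unit P_tangent P_free s S_det). Qed.

Let det_W s : \det (W s) = (-1) ^+ s * D.
Proof. exact: (det_col_mx_row_perm x P). Qed.

Let row_W0 s i : val i = 0%N -> row i (W s) = x.
Proof.
move=> i0; have -> : i = lshift 6 (0 : 'I_1) :> 'I_(1 + 6) by apply/val_inj.
by rewrite [LHS](rowKu (0 : 'I_1) x (row_perm s P)) row_id.
Qed.

Let row_M0 s i : val i = 0%N -> row i (M s) = x.
Proof.
move=> i0; have -> : i = lshift 6 (0 : 'I_1) :> 'I_(1 + 6) by apply/val_inj.
by rewrite [LHS](rowKu (0 : 'I_1) x (row_perm s (invmx G *m P))) row_id.
Qed.

Let row_WS s (i : 'I_7) (j : 'I_6) : i = j.+1 :> nat -> row i (W s) = row (s j) P.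
Proof.
move=> ij; have -> : i = rshift 1 j :> 'I_(1 + 6) by apply/val_inj.
by rewrite [LHS](rowKd j x (row_perm s P)); apply/rowP => p; rewrite !mxE.
Qed.

Let row_MS s (i : 'I_7) (j : 'I_6) : i = j.+1 :> nat -> row i (M s) = row (s j) (invmx G *m P).
Proof.
move=> ij; have -> : i = rshift 1 j :> 'I_(1 + 6) by apply/val_inj.
by rewrite [LHS](rowKd j x (row_perm s (invmx G *m P))); apply/rowP => p; rewrite !mxE.
Qed.

(** The three duals on the hyperplane come from the same bases of R^7, made of x
   and of reordered rows of P; they differ by the place of x.  Here x comes first
   and is an argument of A. *)
Lemma hodge_contraction (A : form R 7 3) (B : form R 7 4) : alternating B ->
  star_pair (k := 3) (l := 4) S A B ->
  is_hodge (k := 2) (l := 4) G (fun V => A (col_mx x (V *m P)))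
    (fun V => eps * B (V *m P)).
Proof.
move=> Ba AB; apply: (@is_hodge_perm R 2 4); first exact/alternatingZ/alternating_mulmx.
move=> s; rewrite !mul_rowsub_mx mul1mx.
have := star_pair_perm (k := 3) (l := 4) 1%g AB (MW s).
rewrite odd_perm1 mul1r det_W.
have -> : rowsub ((1%g : 'S_7) \o @rshift 3 4) (W s) = rowsub (s \o @rshift 2 4) P.
  apply/row_matrixP => i; rewrite !row_rowsub /= perm1.
  by rewrite (@row_WS _ _ (@rshift 2 4 i)).
have -> : rowsub ((1%g : 'S_7) \o @lshift 3 4) (M s) =
    col_mx x (rowsub (s \o @lshift 2 4) (invmx G *m P)) :> 'M[R]_(1 + 2, 7).
  apply/row_matrixP => i; rewrite row_rowsub /= perm1.
  case: (split_ordP i) => i' ->; rewrite ?rowKu ?rowKd ?row_rowsub.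
    by rewrite (ord1 i') row_M0 //; apply/rowP => j; rewrite !mxE.
  by rewrite (@row_MS _ _ (@lshift 2 4 i')).
move=> ->; rewrite G_eps; rewrite -!mulrA mulrCA.
by [].
Qed.

(** Now x is moved behind the three arguments of A, to become the first argument
   of B; this takes three transpositions, hence the sign. *)
Lemma hodge_restriction3 (A : form R 7 3) (B : form R 7 4) : alternating B ->
  star_pair (k := 3) (l := 4) S A B ->
  is_hodge (k := 3) (l := 3) G (fun V => A (V *m P))
    (fun V => - eps * B (col_mx x (V *m P))).
Proof.
move=> Ba AB; apply: (@is_hodge_perm R 3 3).
  by apply/alternatingZ/(@alternating_mulmx _ _ _ _ (fun V => B (col_mx x V)))/(@alternating_col_mxd _ _ 1 3).
move=> s; rewrite !mul_rowsub_mx mul1mx.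
pose j3 : 'I_7 := inord 3.
(* t puts x, the first vector of the frame, in place 3. *)
pose t : 'S_7 := lift_perm j3 ord0 1.
have := star_pair_perm (k := 3) (l := 4) t AB (MW s).
have -> : ((t : bool) = true) by rewrite odd_lift_perm odd_perm1 /= inordK.
rewrite mulN1r det_W.
have -> : rowsub (t \o @rshift 3 4) (W s) =
    col_mx x (rowsub (s \o @rshift 3 3) P) :> 'M[R]_(1 + 3, 7).
  apply/row_matrixP => i; rewrite row_rowsub /=.
  case: (split_ordP i) => i' ->; rewrite ?rowKu ?rowKd ?row_rowsub.
    have -> : rshift 3 (lshift 3 i' : 'I_4) = j3.
      by apply/val_inj; rewrite /= (ord1 i') inordK.
    by rewrite lift_perm_id row_W0 // (ord1 i') row_id.
  have -> : rshift 3 (rshift 1 i' : 'I_4) = lift j3 (@rshift 3 3 i').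
    by apply/val_inj; rewrite /= /bump inordK // leq_addr.
  by rewrite lift_perm_lift perm1 (@row_WS _ _ (@rshift 3 3 i')).
have -> : rowsub (t \o @lshift 3 4) (M s) = rowsub (s \o @lshift 3 3) (invmx G *m P).
  apply/row_matrixP => i; rewrite !row_rowsub /=.
  have -> : lshift 4 i = lift j3 (@lshift 3 3 i).
    by apply/val_inj; rewrite /= /bump inordK // leqNgt ltn_ord.
  by rewrite lift_perm_lift perm1 (@row_MS _ _ (@lshift 3 3 i)).
move=> ->; rewrite G_eps; set a := A _; set sg := _ ^+ s; ring.
Qed.

(** The roles of A and B are exchanged, and x passes four arguments of B. *)
Lemma hodge_restriction4 (A : form R 7 3) (B : form R 7 4) : alternating A ->
  star_pair (k := 4) (l := 3) S B A ->
  is_hodge (k := 4) (l := 2) G (fun V => B (V *m P))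
    (fun V => eps * A (col_mx x (V *m P))).
Proof.
move=> Aa AB; apply: (@is_hodge_perm R 4 2).
  by apply/alternatingZ/(@alternating_mulmx _ _ _ _ (fun V => A (col_mx x V)))/(@alternating_col_mxd _ _ 1 2).
move=> s; rewrite !mul_rowsub_mx mul1mx.
pose j4 : 'I_7 := inord 4.
(* t puts x, the first vector of the frame, in place 4. *)
pose t : 'S_7 := lift_perm j4 ord0 1.
have := star_pair_perm (k := 4) (l := 3) t AB (MW s).
have -> : ((t : bool) = false) by rewrite odd_lift_perm odd_perm1 /= inordK.
rewrite mul1r det_W.
have -> : rowsub (t \o @rshift 4 3) (W s) =
    col_mx x (rowsub (s \o @rshift 4 2) P) :> 'M[R]_(1 + 2, 7).
  apply/row_matrixP => i; rewrite row_rowsub /=.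
  case: (split_ordP i) => i' ->; rewrite ?rowKu ?rowKd ?row_rowsub.
    have -> : rshift 4 (lshift 2 i' : 'I_3) = j4.
      by apply/val_inj; rewrite /= (ord1 i') inordK.
    by rewrite lift_perm_id row_W0 // (ord1 i') row_id.
  have -> : rshift 4 (rshift 1 i' : 'I_3) = lift j4 (@rshift 4 2 i').
    by apply/val_inj; rewrite /= /bump inordK // leq_addr.
  by rewrite lift_perm_lift perm1 (@row_WS _ _ (@rshift 4 2 i')).
have -> : rowsub (t \o @lshift 4 3) (M s) = rowsub (s \o @lshift 4 2) (invmx G *m P).
  apply/row_matrixP => i; rewrite !row_rowsub /=.
  have -> : lshift 3 i = lift j4 (@lshift 4 2 i).
    by apply/val_inj; rewrite /= /bump inordK // leqNgt ltn_ord.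
  by rewrite lift_perm_lift perm1 (@row_MS _ _ (@lshift 4 2 i)).
move=> ->; rewrite G_eps; set b := B _; set sg := _ ^+ s; ring.
Qed.

End Sphere.

(** * Differentials of multilinear expressions *)

Section ExteriorDerivative.
Variable R : realType.

Lemma is_derive_bigsum (V : normedModType R) (I : Type) (r : seq I) (f : I -> V -> R)
    (df : I -> R) (u v : V) : (forall i, is_derive u v (f i) (df i)) ->
  is_derive u v (fun x => \sum_(i <- r) f i x) (\sum_(i <- r) df i).
Proof.
move=> fd; elim: r => [|i r IH].
  rewrite big_nil; under eq_fun do rewrite big_nil; exact: is_derive_cst.
by rewrite big_cons; under eq_fun do rewrite big_cons; exact: is_deriveD.
Qed.

Lemma is_derive_prod (V : normedModType R) k (f : 'I_k -> V -> R)
    (df : 'I_k -> R) (u v : V) : (forall i, is_derive u v (f i) (df i)) ->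
  is_derive u v (fun x => \prod_i f i x)
    (\sum_j \prod_i (if i == j then df i else f i u)).
Proof.
elim: k f df => [|k IH] f df fd.
  by rewrite big_ord0; under eq_fun do rewrite big_ord0; exact: is_derive_cst.
under eq_fun do rewrite big_ord_recl.
apply: is_derive_eq; first exact: (is_deriveM (fd ord0) (IH _ _ (fun i => fd (lift ord0 i)))).
rewrite [RHS]big_ord_recl addrC; congr (_ + _).
  by rewrite [RHS]big_ord_recl eqxx [LHS]mulrC.
rewrite scaler_sumr; apply: eq_bigr => j _; rewrite [RHS]big_ord_recl /=; congr (_ * _).
Qed.

(** The Leibniz rule: one row is differentiated at a time. *)
Lemma is_derive_multilinear (V : normedModType R) n k (a : form R n k)
    (M : V -> 'M[R]_(k, n)) (dM : 'M[R]_(k, n)) (u v : V) : multilinear a ->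
  (forall i c, is_derive u v (fun x => M x i c) (dM i c)) ->
  is_derive u v (fun x => a (M x)) (\sum_j a (set_row j (row j dM) (M u))).
Proof.
move=> am Md; under eq_fun do rewrite multilinear_expand //.
apply: is_derive_eq.
  apply: is_derive_bigsum => h.
  apply: (is_deriveM (is_derive_prod (fun i => Md i (h i))) (is_derive_cst (a (rowsub h 1%:M)) u v)).
under [RHS]eq_bigr do rewrite multilinear_expand //.
rewrite exchange_big; apply: eq_bigr => h _ /=.
rewrite scaler0 add0r [LHS]mulrC mulr_suml; apply: eq_bigr => j _; congr (_ * _).
by apply: eq_bigr => i _; rewrite !mxE; case: eqP => // ->.
Qed.

(** By [sum_det_colsub] it suffices to treat the minors of W.  For these the claim
   is the expansion, along its first column, of the determinant of W preceded by
   the column with entries 1 at i and i' and 0 elsewhere: that matrix has two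
   equal rows. *)
Lemma row'_alternating n k (B : form R n k) (W : 'M[R]_(k.+1, n)) i i' :
  alternating B -> i != i' -> row i W = row i' W ->
  (-1) ^+ i * B (row' i W) + (-1) ^+ i' * B (row' i' W) = 0.
Proof.
move=> Ba ii' rW.
have k0 : k`!%:R != 0 :> R by rewrite pnatr_eq0 -lt0n fact_gt0.
apply: (mulfI k0); rewrite mulr0 mulrDr !(mulrCA k`!%:R).
rewrite -[row' i W]mulmx1 -[row' i' W]mulmx1 -!sum_det_colsub // !mulr_sumr -big_split /=.
rewrite big1 // => h _; rewrite !mulrA -mulrDl.
apply/eqP; rewrite mulf_eq0; apply/orP; left; apply/eqP.
pose y : 'cV[R]_k.+1 := delta_mx i 0 + delta_mx i' 0.
pose Z : 'M[R]_k.+1 := row_mx y (colsub h W).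
have Z0 : \det Z = 0.
  apply: (determinant_alternate ii') => c; rewrite !mxE.
  case: (fintype.split (c : 'I_(1 + k))) => c'; rewrite !mxE ?eqxx ?(eq_sym i') ?(negbTE ii') ?addr0 ?add0r //.
  by have /rowP/(_ (h c')) := rW; rewrite !mxE.
rewrite -[RHS]Z0 (expand_det_col Z ord0).
have yE r : Z r ord0 = (r == i)%:R + (r == i')%:R.
  rewrite (_ : ord0 = lshift k (0 : 'I_1)); last exact/val_inj.
  by rewrite [LHS](row_mxEl y (colsub h W)) !mxE eqxx !andbT.
have cE r : cofactor Z r ord0 = (-1) ^+ r * \det (colsub h (row' r W)).
  rewrite /cofactor addn0; congr (_ * \det _); apply/matrixP => p q.
  transitivity (Z (lift r p) (@rshift 1 k q)).
    by rewrite 2![LHS]mxE; congr (Z _ _); exact/val_inj.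
  by rewrite [LHS](row_mxEr y (colsub h W)) !mxE.
rewrite (bigD1 i) //= (bigD1 i') 1?eq_sym //= big1 => [|r /andP[ri ri']].
  by rewrite addr0 !yE !cE !eqxx (eq_sym i') (negbTE ii') addr0 add0r !mul1r.
by rewrite yE (negbTE ri) (negbTE ri') addr0 mul0r.
Qed.

(** The term that replaces row j by H i j after the deletion of row i cancels the
   one that replaces row i by H j i after the deletion of row j.  With second
   derivatives for H, this is why d of a pullback involves first derivatives
   only. *)
Lemma alternating_sum_symmetric n k (B : form R n k) (Y : 'M[R]_(k.+1, n))
    (H : 'I_k.+1 -> 'I_k.+1 -> 'rV[R]_n) :
  alternating B -> (forall i j, H i j = H j i) ->
  \sum_(i < k.+1) (-1) ^+ i * \sum_(j < k) B (set_row j (H i (lift i j)) (row' i Y)) = 0.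
Proof.
move=> Ba Hs.
pose Z i i' := set_row i (H i i') (set_row i' (H i i') Y).
pose c (i i' : 'I_k.+1) : R := if i' == i then 0 else (-1) ^+ i * B (row' i (Z i i')).
have cN i i' : c i i' = - c i' i.
  rewrite /c eq_sym; case: eqVneq => [_|ii']; first by rewrite oppr0.
  have ZC : Z i' i = Z i i'.
    rewrite /Z Hs; apply/matrixP => p q; rewrite !mxE.
    by case: eqP => // _; case: eqP.
  apply/eqP; rewrite -addr_eq0 ZC; apply/eqP/row'_alternating => //.
  by rewrite /Z row_set_row row_set_row_neq 1?eq_sym // row_set_row.
transitivity (\sum_i \sum_i' c i i').
  apply: eq_bigr => i _; rewrite (bigD1_ord i) //= {1}/c eqxx add0r mulr_sumr.
  apply: eq_bigr => j _; rewrite /c eq_sym (negbTE (neq_lift i j)); congr (_ * B _).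
  apply/matrixP => p q; rewrite !mxE (eq_sym (lift i p) i) (negbTE (neq_lift i p)).
  by rewrite (inj_eq lift_inj).
set s := LHS; have : s + s = 0.
  rewrite {2}/s exchange_big /= /s -big_split big1 // => i _ /=.
  by rewrite -big_split big1 // => i' _ /=; rewrite (cN i) addNr.
by move/eqP; rewrite -mulr2n mulrn_eq0 /= => /eqP.
Qed.

Lemma alternating_row_first n k (A : form R n (1 + k)) (Y : 'M[R]_(k.+1, n)) i :
  alternating A -> A (col_mx (row i Y) (row' i Y)) = (-1) ^+ i * A Y.
Proof.
move=> Aa.
have -> : col_mx (row i Y) (row' i Y) = row_perm (lift_perm ord0 i 1) Y.
  apply/row_matrixP => r.
  have -> (s : 'S_k.+1) : row r (row_perm s Y) = row (s r) Y by apply/rowP => c; rewrite !mxE.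
  case: (split_ordP (r : 'I_(1 + k))) => r' ->; rewrite ?rowKu ?rowKd.
    rewrite (_ : lshift k r' = ord0); last by apply/val_inj; rewrite /= (ord1 r').
    by rewrite lift_perm_id row_id.
  rewrite (_ : rshift 1 r' = lift ord0 r'); last exact/val_inj.
  by rewrite lift_perm_lift perm1; apply/rowP => c; rewrite !mxE.
by rewrite alternating_row_perm // odd_lift_perm odd_perm1 addbF signr_odd.
Qed.

End ExteriorDerivative.

(** * Symmetry of second derivatives *)

Lemma half_distance (R : realType) (a b c e : R) :
  `|b - a| < e / 2 -> `|c - a| < e / 2 -> `|b - c| <= e.
Proof.
move=> ba ca; rewrite (splitr e) -(subrKA a) (le_trans (ler_normD _ _)) //.
by rewrite (distrC a c) ltW // ltrD.
Qed.

Section Schwarz.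
Variables (R : realType) (V : normedModType R).

Lemma is_derive_line (f : V -> R) (p v : V) (t : R) : derivable f (t *: v + p) v ->
  is_derive t 1 (fun s => f (s *: v + p)) ('D_v f (t *: v + p)).
Proof.
have E : (fun h : R => h^-1 *: (((fun s => f (s *: v + p)) \o shift t) (h *: 1) - f (t *: v + p)))
       = (fun h : R => h^-1 *: ((f \o shift (t *: v + p)) (h *: v) - f (t *: v + p))).
  by apply/funext => h; rewrite /= [h%:A]mulr1 scalerDl addrA.
by move=> fd; split; rewrite /derivable /derive E.
Qed.

(** The mean value theorem, first in the direction v and then in the direction
   w. *)
Lemma second_difference (f : V -> R) (u v w : V) (h : R) : 0 < h ->
  (forall s t : R, 0 <= s <= h -> 0 <= t <= h ->
    derivable f (s *: v + (t *: w + u)) v /\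
    derivable ('D_v f) (s *: v + (t *: w + u)) w) ->
  exists s t : R, [/\ 0 <= s <= h, 0 <= t <= h &
    f (h *: v + (h *: w + u)) - f (h *: v + u) - (f (h *: w + u) - f u)
    = h ^+ 2 * 'D_w ('D_v f) (s *: v + (t *: w + u))].
Proof.
move=> h0 fd.
have hh : 0 <= h <= h by rewrite ltW //= lexx.
have h00 : (0 : R) <= (0 : R) <= h by rewrite lexx ltW.
pose F s := f (s *: v + (h *: w + u)) - f (s *: v + u).
pose dF s := 'D_v f (s *: v + (h *: w + u)) - 'D_v f (s *: v + u).
have Fd (s : R) : 0 <= s <= h -> is_derive s 1 F (dF s).
  move=> sh; apply: is_deriveB; apply: is_derive_line.
    exact: (fd _ _ sh hh).1.
  by have := (fd _ _ sh h00).1; rewrite scale0r add0r.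
have [|s|s sh Fs] := @MVT R F dF 0 h h0.
- by move=> x; rewrite in_itv /= => /andP[/ltW x0 /ltW xh]; apply: Fd; rewrite x0.
- move: s; apply: derivable_within_continuous => x; rewrite in_itv /= => xh.
  by have [] := Fd x xh.
have {}sh : 0 <= s <= h by move: sh; rewrite in_itv /= => /andP[/ltW -> /ltW].
pose K t := 'D_v f (t *: w + (s *: v + u)).
pose dK t := 'D_w ('D_v f) (t *: w + (s *: v + u)).
have Kd (t : R) : 0 <= t <= h -> is_derive t 1 K (dK t).
  move=> th; apply: is_derive_line; rewrite addrCA.
  exact: (fd _ _ sh th).2.
have [|t|t th Kt] := @MVT R K dK 0 h h0.
- by move=> x; rewrite in_itv /= => /andP[/ltW x0 /ltW xh]; apply: Kd; rewrite x0.
- move: t; apply: derivable_within_continuous => x; rewrite in_itv /= => xh.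
  by have [] := Kd x xh.
exists s, t; split => //.
  by move: th; rewrite in_itv /= => /andP[/ltW -> /ltW].
move: Fs; rewrite /F !scale0r !add0r subr0 => ->.
move: Kt; rewrite /K /dK scale0r add0r subr0 => Kt.
by rewrite /dF (addrCA (s *: v)) Kt (addrCA (s *: v)) expr2; ring.
Qed.

(** The second difference is symmetric in v and w, so both mixed derivatives take
   equal values at points arbitrarily close to u. *)
Lemma derive_symmetric (f : V -> R) (u v w : V) :
  (\forall x \near u, [/\ derivable f x v, derivable f x w,
     derivable ('D_v f) x w & derivable ('D_w f) x v]) ->
  {for u, continuous ('D_w ('D_v f))} -> {for u, continuous ('D_v ('D_w f))} ->
  'D_w ('D_v f) u = 'D_v ('D_w f) u.
Proof.
move=> nd c1 c2; apply/eqP; rewrite -subr_eq0 -normr_le0; apply/ler_addgt0Pr => e e0.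
rewrite add0r.
have e2 : 0 < e / 2 by rewrite divr_gt0.
have := nd; move=> /nbhs_ballP[d1 /= d10 dP1].
have := c1; move=> /cvgrPdist_lt /(_ _ e2) /nbhs_ballP[d2 /= d20 dP2].
have := c2; move=> /cvgrPdist_lt /(_ _ e2) /nbhs_ballP[d3 /= d30 dP3].
pose d := Num.min d1 (Num.min d2 d3).
have d0 : 0 < d by rewrite !lt_min d10 d20.
have [dd1 dd2 dd3] : [/\ d <= d1, d <= d2 & d <= d3].
  by split; rewrite !ge_min lexx ?orbT.
pose h := d / (2 * (`|v| + `|w| + 1)).
have N0 : 0 < `|v| + `|w| + 1 by rewrite ltr_wpDl ?addr_ge0.
have h0 : 0 < h by rewrite divr_gt0 ?mulr_gt0.
have inb (s t : R) : 0 <= s <= h -> 0 <= t <= h -> ball u d (s *: v + (t *: w + u)).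
  move=> /andP[s0 sh] /andP[t0 th]; rewrite -ball_normE /= distrC addrA addrK.
  apply: (@le_lt_trans _ _ (h * (`|v| + `|w|))).
    rewrite mulrDr (le_trans (ler_normD _ _)) // !normrZ !ger0_norm //.
    by rewrite lerD // ler_wpM2r.
  rewrite (@lt_le_trans _ _ (h * (`|v| + `|w| + 1))) ?ltr_pM2l ?ltrDl //.
  by rewrite /h invfM mulrA mulfVK ?gt_eqF // ler_pdivrMr // mulr_natr mulr2n lerDl ltW.
have [|s [t [sh th E1]]] := @second_difference f u v w h h0.
  by move=> s t sh th; have [] := dP1 _ (le_ball dd1 (inb s t sh th)).
have inb' (s' t' : R) : 0 <= s' <= h -> 0 <= t' <= h -> ball u d (s' *: w + (t' *: v + u)).
  by move=> s'h t'h; rewrite addrCA; apply: inb.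
have [|s' [t' [s'h t'h E2]]] := @second_difference f u w v h h0.
  by move=> a b ah bh; have [] := dP1 _ (le_ball dd1 (inb' a b ah bh)).
set p := s *: v + (t *: w + u) in E1; set q := s' *: w + (t' *: v + u) in E2.
have b1 : `|'D_w ('D_v f) u - 'D_w ('D_v f) p| < e / 2 := dP2 _ (le_ball dd2 (inb s t sh th)).
have b2 : `|'D_v ('D_w f) u - 'D_v ('D_w f) q| < e / 2 := dP3 _ (le_ball dd3 (inb' s' t' s'h t'h)).
have eqD : 'D_w ('D_v f) p = 'D_v ('D_w f) q.
  have hn0 : h ^+ 2 != 0 by rewrite expf_eq0 /= gt_eqF.
  by apply: (mulfI hn0); rewrite -E1 -E2 (addrCA (h *: w)); ring.
rewrite eqD in b1; exact: (half_distance b1 b2).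
Qed.

End Schwarz.

(** * Exterior derivatives of pulled back constant forms *)

Lemma near_open (T : topologicalType) (U : set T) (x : T) :
  open U -> U x -> \forall y \near x, U y.
Proof. by move=> Uo Ux; apply: open_nbhs_nbhs. Qed.

Section PullbackDerivative.
Variables (R : realType) (n m : nat) (U : set 'rV[R]_n) (phi : 'rV[R]_n -> 'rV[R]_m).

Lemma is_derive_coord (f : 'rV[R]_n -> 'rV[R]_m) u v c : differentiable f u ->
  is_derive u v (fun x => f x 0 c) ('D_v f u 0 c).
Proof.
move=> /diff_derivable fd; have {}fd := fd v.
split; first exact: (derivable_mxP _ _ _).1 fd 0 c.
by rewrite derive_mx // mxE.
Qed.

Hypothesis U_open : open U.
Hypothesis phi_diff : forall x, U x -> differentiable phi x.
Hypothesis phi_diff2 : forall v x, U x -> differentiable ('D_v phi) x.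
Hypothesis phi_sym : forall v w x, U x -> 'D_w ('D_v phi) x = 'D_v ('D_w phi) x.

Lemma derive_jacobian k (W : 'M[R]_(k, n)) x j c : U x ->
  (W *m 'J phi x) j c = 'D_(row j W) phi x 0 c.
Proof. by move=> /phi_diff /deriveEjacobian ->; rewrite -row_mul [RHS]mxE. Qed.

Lemma is_derive_jacobian k (W : 'M[R]_(k, n)) u v j c : U u ->
  is_derive u v (fun x => (W *m 'J phi x) j c) ('D_v ('D_(row j W) phi) u 0 c).
Proof.
move=> Uu.
have dphi : differentiable ('D_(row j W) phi) u 
  by exact: phi_diff2.
have dcoord := @is_derive_coord ('D_(row j W) phi) u v c dphi.
apply: near_eq_is_derive dcoord.
by apply: filterS (near_open U_open Uu) => x Ux; rewrite derive_jacobian.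
Qed.

(** Only the Jacobian depends on the point, so every term of the differential
   contains a second derivative. *)
Lemma extd_pullback_const k (A : form R m k) u V : alternating A -> U u ->
  extd (fun x (V : 'M[R]_(k, n)) => A (V *m 'J phi x)) u V = 0.
Proof.
move=> Aa Uu; pose H i j := 'D_(row i V) ('D_(row j V) phi) u.
have Hs i j : H i j = H j i by exact: phi_sym.
have S0 := alternating_sum_symmetric (V *m 'J phi u) Aa Hs.
apply: etrans S0.
apply: eq_bigr => i _; congr (_ * _).
pose dM : 'M[R]_(k, m) := \matrix_(j, c) 'D_(row i V) ('D_(row j (row' i V)) phi) u 0 c.
have Md j c : is_derive u (row i V) (fun x => (row' i V *m 'J phi x) j c) (dM j c).
  by rewrite mxE; apply: is_derive_jacobian.
have /@derive_val -> := is_derive_multilinear Aa.1 Md.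
apply: eq_bigr => j _; congr (A _); apply/matrixP => p q.
have rE : row j (row' i V) = row (lift i j) V by apply/rowP => c; rewrite !mxE.
rewrite ![in LHS]mxE ![in RHS]mxE rE; case: eqP => // _.
by apply: eq_bigr => l _; rewrite !mxE.
Qed.

(** Differentiating phi in the first argument of A restores the deleted vector in
   front of the others, and each of the k + 1 terms equals A on all vectors.
   Differentiating the Jacobian gives second derivatives, which cancel. *)
Lemma extd_pullback_contraction k (A : form R m (1 + k)) u V : alternating A -> U u ->
  extd (fun x (V : 'M[R]_(k, n)) => A (col_mx (phi x) (V *m 'J phi x))) u V =
  k.+1%:R * A (V *m 'J phi u).
Proof.
move=> Aa Uu; pose Y := V *m 'J phi u.
pose H i j := 'D_(row i V) ('D_(row j V) phi) u.
have Hs i j : H i j = H j i by exact: phi_sym.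
have Ba := alternating_col_mxd (phi u) Aa.
have S0 := alternating_sum_symmetric Y Ba Hs.
transitivity (\sum_(i < k.+1) ((-1) ^+ i * A (col_mx (row i Y) (row' i Y)) +
   (-1) ^+ i * \sum_(j < k) A (col_mx (phi u) (set_row j (H i (lift i j)) (row' i Y))))); last first.
  rewrite big_split /= [X in _ + X]S0 addr0 (eq_bigr (fun=> A Y)).
    by rewrite sumr_const card_ord mulr_natl.
  by move=> i _; rewrite alternating_row_first // mulrA -expr2 sqrr_sign mul1r.
apply: eq_bigr => i _; rewrite -mulrDr; congr (_ * _).
pose dM : 'M[R]_(1 + k, m) :=
  col_mx ('D_(row i V) phi u) (\matrix_(j, c) 'D_(row i V) ('D_(row j (row' i V)) phi) u 0 c).
have Md j c : is_derive u (row i V) (fun x => (col_mx (phi x) (row' i V *m 'J phi x)) j c) (dM j c).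
  case: (split_ordP j) => j' ->; rewrite ?col_mxEu ?col_mxEd.
    rewrite (_ : (fun x => _) = (fun x => phi x 0 c)).
      by rewrite (ord1 j'); apply: is_derive_coord; exact: phi_diff.
    by apply/funext => x; rewrite [LHS]col_mxEu (ord1 j').
  rewrite (_ : (fun x => _) = (fun x => (row' i V *m 'J phi x) j' c)); last first.
    by apply/funext => x; rewrite [LHS]col_mxEd.
  by rewrite mxE; apply: is_derive_jacobian.
have /@derive_val -> := is_derive_multilinear Aa.1 Md.
rewrite big_split_ord big_ord1 /=; congr (_ + _).
  congr (A _); apply/row_matrixP => r; case: (split_ordP r) => r' ->.
    rewrite (ord1 r') row_set_row !rowKu !row_id row_mul -deriveEjacobian //.
    exact: phi_diff.
  rewrite row_set_row_neq ?eq_rlshift // !rowKd; congr (row _ _).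
  by apply/matrixP => p q; rewrite !mxE; apply: eq_bigr => l _; rewrite !mxE.
apply: eq_bigr => j _; congr (A _); apply/row_matrixP => r; case: (split_ordP r) => r' ->.
  by rewrite row_set_row_neq ?eq_lrshift // !rowKu.
rewrite rowKd; case: (eqVneq r' j) => [->|rj].
  have rE : row j (row' i V) = row (lift i j) V by apply/rowP => c; rewrite !mxE.
  by rewrite !row_set_row rowKd; apply/rowP => c; rewrite !mxE rE.
rewrite !row_set_row_neq ?eq_rshift // rowKd; apply/rowP => c; rewrite !mxE.
by apply: eq_bigr => l _; rewrite !mxE.
Qed.

End PullbackDerivative.

(** * The Cayley 3-form and parametrizations of the sphere *)

(** Names the coordinates of a vector, so that [ring] meets variables rather than
   matrix entries that it would have to compare. *)
Ltac gen_coords X :=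
  move: (X 0 0) (X 0 1) (X 0 2) (X 0 3) (X 0 4) (X 0 5) (X 0 6) => ? ? ? ? ? ? ?.

Section CayleyForm.
Variable R : realType.

Lemma gE (X Y : 'rV[R]_7) : g X Y =
  X 0 0 * Y 0 0 + X 0 1 * Y 0 1 + X 0 2 * Y 0 2
  - X 0 3 * Y 0 3 - X 0 4 * Y 0 4 - X 0 5 * Y 0 5 - X 0 6 * Y 0 6.
Proof.
have E (Z : 'rV[R]_7) (i j : 'I_7) : val i = val j -> Z 0 i = Z 0 j by move/val_inj ->.
rewrite /g /g34 mul_mx_diag mxE !big_ord_recl big_ord0 !mxE /=.
rewrite !(E _ ord0 0) // !(E _ (lift ord0 ord0) 1) //.
rewrite !(E _ (lift ord0 (lift ord0 ord0)) 2) //.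
rewrite !(E _ (lift ord0 (lift ord0 (lift ord0 ord0))) 3) //.
rewrite !(E _ (lift ord0 (lift ord0 (lift ord0 (lift ord0 ord0)))) 4) //.
rewrite !(E _ (lift ord0 (lift ord0 (lift ord0 (lift ord0 (lift ord0 ord0))))) 5) //.
rewrite !(E _ (lift ord0 (lift ord0 (lift ord0 (lift ord0 (lift ord0 (lift ord0 ord0)))))) 6) //.
by ring.
Qed.

Lemma crossE (X Y : 'rV[R]_7) : cross X Y = \row_(i < 7) [::
  X 0 1 * Y 0 2 - X 0 2 * Y 0 1 + X 0 4 * Y 0 3 - X 0 3 * Y 0 4 - X 0 6 * Y 0 5 + X 0 5 * Y 0 6;
  X 0 2 * Y 0 0 - X 0 0 * Y 0 2 + X 0 5 * Y 0 3 + X 0 6 * Y 0 4 - X 0 3 * Y 0 5 - X 0 4 * Y 0 6;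
  X 0 0 * Y 0 1 - X 0 1 * Y 0 0 + X 0 6 * Y 0 3 - X 0 5 * Y 0 4 + X 0 4 * Y 0 5 - X 0 3 * Y 0 6;
  X 0 4 * Y 0 0 + X 0 5 * Y 0 1 + X 0 6 * Y 0 2 - X 0 0 * Y 0 4 - X 0 1 * Y 0 5 - X 0 2 * Y 0 6;
  X 0 0 * Y 0 3 + X 0 2 * Y 0 5 - X 0 1 * Y 0 6 - X 0 3 * Y 0 0 - X 0 5 * Y 0 2 + X 0 6 * Y 0 1;
  X 0 1 * Y 0 3 - X 0 2 * Y 0 4 + X 0 0 * Y 0 6 - X 0 3 * Y 0 1 + X 0 4 * Y 0 2 - X 0 6 * Y 0 0;
  X 0 2 * Y 0 3 + X 0 1 * Y 0 4 - X 0 0 * Y 0 5 - X 0 3 * Y 0 2 - X 0 4 * Y 0 1 + X 0 5 * Y 0 0]`_i.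
Proof.
apply/rowP => i; rewrite /cross /mulc /imc /Imc /addq /mulq /conjq /=.
rewrite !mxE; gen_coords X; gen_coords Y.
by case: i => -[|[|[|[|[|[|[|//]]]]]]] ? /=; ring.
Qed.

(** The 3-form whose stabilizer in GL_7 is the split form of G_2. *)
Definition cayley3 : form R 7 3 := fun V => g (cross (row 0 V) (row 1 V)) (row 2 V).

Lemma cross_linearl b c (X X' Y : 'rV[R]_7) :
  cross (b *: X + c *: X') Y = b *: cross X Y + c *: cross X' Y.
Proof.
apply/rowP => i; rewrite !crossE !mxE.
gen_coords X; gen_coords X'; gen_coords Y.
by case: i => -[|[|[|[|[|[|[|//]]]]]]] ? /=; ring.
Qed.

Lemma cross_linearr b c (X Y Y' : 'rV[R]_7) :
  cross X (b *: Y + c *: Y') = b *: cross X Y + c *: cross X Y'.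
Proof.
apply/rowP => i; rewrite !crossE !mxE.
gen_coords X; gen_coords Y; gen_coords Y'.
by case: i => -[|[|[|[|[|[|[|//]]]]]]] ? /=; ring.
Qed.

Lemma g_linearl b c (X X' Y : 'rV[R]_7) : g (b *: X + c *: X') Y = b * g X Y + c * g X' Y.
Proof. by rewrite /g !mulmxDl -!scalemxAl !mxE. Qed.

Lemma g_linearr b c (X Y Y' : 'rV[R]_7) : g X (b *: Y + c *: Y') = b * g X Y + c * g X Y'.
Proof. by rewrite /g linearP /= linearZ /= mulmxDr -!scalemxAr !mxE. Qed.

Lemma cross_self (X : 'rV[R]_7) : cross X X = 0.
Proof.
apply/rowP => i; rewrite !crossE !mxE.
gen_coords X.
by case: i => -[|[|[|[|[|[|[|//]]]]]]] ? /=; ring.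
Qed.

Lemma g_cross_l (X Y : 'rV[R]_7) : g (cross X Y) X = 0.
Proof.
rewrite gE crossE !mxE /=.
gen_coords X; gen_coords Y.
by ring.
Qed.

Lemma g_cross_r (X Y : 'rV[R]_7) : g (cross X Y) Y = 0.
Proof.
rewrite gE crossE !mxE /=.
gen_coords X; gen_coords Y.
by ring.
Qed.

Lemma ord3_cases (i : 'I_3) : i = 0 \/ i = 1 \/ i = 2.
Proof. by case: i => -[|[|[|//]]] i3; [left|right; left|right; right]; apply/val_inj. Qed.

Lemma alternating_cayley3 : alternating cayley3.
Proof.
split=> [i b c A B C rA /eq_row'P rB /eq_row'P rC|i j A ij rij]; rewrite /cayley3.
  have [i0|[i1|i2]] := ord3_cases i; subst i.
  - by rewrite !(rB 1) ?(rB 2) ?(rC 1) ?(rC 2) // rA cross_linearl g_linearl.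
  - by rewrite !(rB 0) ?(rB 2) ?(rC 0) ?(rC 2) // rA cross_linearr g_linearl.
  - by rewrite !(rB 0) ?(rB 1) ?(rC 0) ?(rC 1) // rA g_linearr.
have [r01|[r02|r12]] : row 0 A = row 1 A \/ row 0 A = row 2 A \/ row 1 A = row 2 A.
- by have [|[]] := ord3_cases i => ?; have [|[]] := ord3_cases j => ?; subst i j => //; auto.
- by rewrite r01 cross_self /g !mul0mx mxE.
- by rewrite r02 g_cross_l.
- by rewrite r12 g_cross_r.
Qed.

Lemma omegaE x (V : 'M[R]_(2, 7)) :
  omega x V = cayley3 (col_mx x V : 'M[R]_(1 + 2, 7)).
Proof.
rewrite /omega /J /cayley3; set W : 'M[R]_(3, 7) := col_mx x V.
have -> : row 0 W = x.
  by rewrite (_ : 0 = lshift 2 (0 : 'I_1)) ?[LHS]rowKu ?row_id //; apply/val_inj.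
have -> : row 1 W = row 0 V.
  by rewrite (_ : 1 = rshift 1 (0 : 'I_2)) ?[LHS]rowKd //; apply/val_inj.
have -> // : row 2 W = row 1 V.
by rewrite (_ : 2 = rshift 1 (1 : 'I_2)) ?[LHS]rowKd //; apply/val_inj.
Qed.

(** At e_1 the form takes the value g (e_1 x e_2, e_3) = g (e_3, e_3) = 1. *)
Lemma omega_nonzero : exists (x : 'rV[R]_7) (V : 'M[R]_(2, 7)),
  [/\ S24 x, forall i, tangent x (row i V) & omega x V != 0].
Proof.
exists (\row_j (val j == 0)%N%:R), (\matrix_(i, j) (val j == (val i).+1)%N%:R); split.
- by rewrite /S24 /= gE !mxE /= mul1r mul0r !subr0 !addr0.
- by move=> i; rewrite /tangent gE !mxE /= !mul0r mulr0 !subr0 !addr0.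
- rewrite /omega /J gE crossE !mxE /=.
  by rewrite !mul0r !mulr0 !subr0 !addr0 add0r !mulr1 oner_neq0.
Qed.

Lemma g34_sym : (g34 R)^T = g34 R.
Proof. by rewrite /g34 tr_diag_mx. Qed.

Lemma det_g34 : \det (g34 R) = 1.
Proof. by rewrite /g34 det_diag !big_ord_recl big_ord0 !mxE /=; ring. Qed.

Lemma S24_gram (x : 'rV[R]_7) : S24 x -> x *m g34 R *m x^T = 1%:M.
Proof. by move=> xS; rewrite [LHS]mx11_scalar; congr (_%:M). Qed.

End CayleyForm.

Section Local.
Variable R : realType.

Lemma near_sg (V : normedModType R) (f : V -> R) (u : V) : continuous_at u f ->
  f u != 0 -> \forall x \near u, Num.sg (f x) = Num.sg (f u).
Proof.
move=> fc; case: (ltgtP (f u) 0) => // fu _.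
  have flt : \forall x \near u, f x < 0 by apply: cvgr_lt fc _ fu.
  by apply: filterS flt => x fx; rewrite !ltr0_sg.
have fgt : \forall x \near u, 0 < f x by apply: cvgr_gt fc _ fu.
by apply: filterS fgt => x fx; rewrite !gtr0_sg.
Qed.

Lemma continuous_at_sum (V : normedModType R) (I : Type) (r : seq I) (f : I -> V -> R) u :
  (forall i, continuous_at u (f i)) -> continuous_at u (fun x => \sum_(i <- r) f i x).
Proof.
move=> fc; elim: r => [|i r IH].
  by under eq_fun do rewrite big_nil; exact: cvg_cst.
by under eq_fun do rewrite big_cons; exact: (continuousD (fc i) IH).
Qed.

Lemma continuous_at_prod (V : normedModType R) (I : Type) (r : seq I) (f : I -> V -> R) u :
  (forall i, continuous_at u (f i)) -> continuous_at u (fun x => \prod_(i <- r) f i x).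
Proof.
move=> fc; elim: r => [|i r IH].
  by under eq_fun do rewrite big_nil; exact: cvg_cst.
by under eq_fun do rewrite big_cons; exact: (continuousM (fc i) IH).
Qed.

Lemma continuous_at_det (V : normedModType R) k (M : V -> 'M[R]_k) u :
  (forall i j, continuous_at u (fun x => M x i j)) ->
  continuous_at u (fun x => \det (M x)).
Proof.
move=> Mc; apply: continuous_at_sum => s.
have prodc : continuous_at u (fun x => \prod_i M x i (s i)).
  by apply: continuous_at_prod => i; apply: Mc.
have signc : continuous_at u (fun=> (-1) ^+ s : R) by exact: cvg_cst.
exact: (continuousM signc prodc).
Qed.

Lemma near_eq_continuous (V : normedModType R) (f f' : V -> R) (u : V) :
  (\forall x \near u, f x = f' x) -> continuous_at u f' -> continuous_at u f.
Proof.
move=> ff' fc; rewrite /continuous_at (nbhs_singleton ff').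
by apply: cvg_trans fc; apply: near_eq_cvg; apply: filterS ff' => x ->.
Qed.

Lemma continuous_at_coord n m (f : 'rV[R]_n -> 'rV[R]_m) u c :
  continuous_at u f -> continuous_at u (fun x => f x 0 c).
Proof. by move=> fc; exact: (continuous_comp fc (@coord_continuous R 1 m 0 c (f u))). Qed.

End Local.

Section Parametrization.
Variables (R : realType) (U : set 'rV[R]_6) (phi : 'rV[R]_6 -> 'rV[R]_7).
Hypothesis phiP : parametrization U phi.

Let U_open : open U. Proof. by case: phiP. Qed.

Lemma param_diff x : U x -> differentiable phi x.
Proof. by case: phiP => _ /(_ 1%N)[H _] _ _ _ /H. Qed.

Lemma param_diff2 v x : U x -> differentiable ('D_v phi) x.
Proof. by case: phiP => _ /(_ 2)[_ /(_ v)[H _]] _ _ _ /H. Qed.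

Lemma param_cont2 v w x : U x -> continuous_at x ('D_w ('D_v phi)).
Proof. by case: phiP => _ /(_ 2)[_ /(_ v)[_ /(_ w) H]] _ _ _ /H. Qed.

Lemma param_sym v w x : U x -> 'D_w ('D_v phi) x = 'D_v ('D_w phi) x.
Proof.
move=> Ux; apply/rowP => c; pose f y := phi y 0 c.
have fE v' y : U y -> 'D_v' f y = 'D_v' phi y 0 c.
  by move=> /param_diff phid; have /@derive_val := is_derive_coord v' c phid.
have nfE v' y : U y -> \forall z \near y, 'D_v' phi z 0 c = 'D_v' f z.
  by move=> Uy; apply: filterS (near_open U_open Uy) => z Uz; rewrite fE.
have fE2 v' w' y : U y -> is_derive y w' ('D_v' f) ('D_w' ('D_v' phi) y 0 c).
  move=> Uy; apply: near_eq_is_derive (nfE v' y Uy) _.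
  by apply: is_derive_coord; apply: param_diff2.
have fD v' y : U y -> derivable f y v'.
  by move=> /param_diff phid; have /@ex_derive := is_derive_coord v' c phid.
have fD2 v' w' y : U y -> derivable ('D_v' f) y w'.
  by move=> Uy; have /@ex_derive := fE2 v' w' y Uy.
have f2E v' w' y : U y -> 'D_w' ('D_v' f) y = 'D_w' ('D_v' phi) y 0 c.
  by move=> Uy; have /@derive_val := fE2 v' w' y Uy.
transitivity ('D_w ('D_v f) x); first by rewrite f2E.
transitivity ('D_v ('D_w f) x); last by rewrite f2E.
apply: derive_symmetric.
- by apply: filterS (near_open U_open Ux) => y Uy; split; [exact: fD|exact: fD|exact: fD2|exact: fD2].
- apply: (@near_eq_continuous _ _ _ (fun y => 'D_w ('D_v phi) y 0 c)).
    by apply: filterS (near_open U_open Ux) => y Uy; exact: f2E.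
  by apply: continuous_at_coord; exact: param_cont2.
- apply: (@near_eq_continuous _ _ _ (fun y => 'D_v ('D_w phi) y 0 c)).
    by apply: filterS (near_open U_open Ux) => y Uy; exact: f2E.
  by apply: continuous_at_coord; exact: param_cont2.
Qed.

Lemma param_unit x : U x -> phi x *m g34 R *m (phi x)^T = 1%:M.
Proof. by move=> Ux; apply: S24_gram; case: phiP => _ _ /(_ _ Ux). Qed.

Lemma param_free x : U x -> row_free ('J phi x).
Proof. by case: phiP => _ _ _ _; apply. Qed.

Lemma g_diag (X Y : 'rV[R]_7) :
  g X Y = \sum_(c < 7) (if (c < 3)%N then 1 else -1) * (X 0 c * Y 0 c).
Proof.
rewrite /g /g34 mul_mx_diag mxE; apply: eq_bigr => c _; rewrite !mxE mulrAC mulrC.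
by [].
Qed.

(** The derivative of the constant function g (phi, phi). *)
Lemma param_tangent x : U x -> 'J phi x *m g34 R *m (phi x)^T = 0.
Proof.
move=> Ux; apply/row_matrixP => i; rewrite row0 !row_mul; set v := row i _.
rewrite [LHS]mx11_scalar (_ : _ 0 0 = 0) ?raddf0 // -/(g v (phi x)).
have vE c : is_derive x (delta_mx 0 i) (fun y => phi y 0 c) (v 0 c).
  have := is_derive_coord (delta_mx 0 i) c (param_diff Ux).
  by rewrite deriveEjacobian -?rowE //; exact: param_diff.
pose s (c : 'I_7) : R := if (c < 3)%N then 1 else -1.
have q1 : is_derive x (delta_mx 0 i) (fun y => \sum_c s c * (phi y 0 c * phi y 0 c)) (2 * g v (phi x)).
  have qc c : is_derive x (delta_mx 0 i) (fun y => s c * (phi y 0 c * phi y 0 c))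
      (2 * (s c * (v 0 c * phi x 0 c))).
    have qc := is_deriveM (is_derive_cst (s c) x (delta_mx 0 i)) (is_deriveM (vE c) (vE c)).
    apply: (is_derive_eq qc); rewrite scaler0 addr0.
    by rewrite -[LHS]/(s c * (phi x 0 c * v 0 c + phi x 0 c * v 0 c)); ring.
  by rewrite g_diag mulr_sumr; exact: is_derive_bigsum.
have q0 : is_derive x (delta_mx 0 i) (fun y => \sum_c s c * (phi y 0 c * phi y 0 c)) 0.
  have c1 := is_derive_cst (1 : R) x (delta_mx 0 i : 'rV[R]_6).
  apply: near_eq_is_derive c1.
  apply: filterS (near_open U_open Ux) => y Uy; rewrite -g_diag.
  by case: phiP => _ _ /(_ _ Uy) <-.
have : 2 * g v (phi x) = 0 by rewrite -(@derive_val _ _ _ _ _ _ _ q1) (@derive_val _ _ _ _ _ _ _ q0).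
by move/eqP; rewrite mulf_eq0 pnatr_eq0 /= => /eqP.
Qed.

(** Compares the volume form of the coordinates, in which the Hodge operator is
   taken, with the one that the normal vector induces on the sphere. *)
Definition orientation x : R := Num.sg (\det (col_mx (phi x) ('J phi x) : 'M[R]_(1 + 6))).

(** The determinant is continuous, and the normal vector and a basis of tangent
   vectors are independent. *)
Lemma orientation_near x : U x -> \forall y \near x, orientation y = orientation x.
Proof.
move=> Ux; apply: (near_sg (f := fun y => \det (col_mx (phi y) ('J phi y) : 'M[R]_(1 + 6)))).
  apply: continuous_at_det => i j; case: (split_ordP i) => i' ->.
    rewrite (_ : (fun y => _) = (fun y => phi y 0 j)); last first.
      by apply/funext => y; rewrite col_mxEu (ord1 i').
    by apply: continuous_at_coord; apply: differentiable_continuous; apply: param_diff.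
  rewrite (_ : (fun y => _) = (fun y => 'J phi y i' j)); last first.
    by apply/funext => y; rewrite col_mxEd.
  apply: (@near_eq_continuous _ _ _ (fun y => 'D_(row i' 1%:M) phi y 0 j)).
    apply: filterS (near_open U_open Ux) => y Uy.
    by rewrite -(derive_jacobian param_diff) // mul1mx.
  apply: continuous_at_coord; apply: differentiable_continuous; exact: param_diff2.
have := adapted_unitmx (param_unit Ux) (param_tangent Ux) (param_free Ux).
by rewrite unitmxE unitfE.
Qed.

End Parametrization.

(** * The Laplacian *)

Section LaplacianOmega.
Variable R : realType.

Lemma is_hodge0 k l (G : 'M[R]_(k + l)) : is_hodge (k := k) (l := l) G (fun=> 0) (fun=> 0).
Proof.
split=> [|a _ V]; first by split=> [i b c *|i j *]; rewrite ?mulr0 ?addr0.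
rewrite /wedge /inner_form big1 ?mulr0; last by move=> s _; rewrite !mulr0.
by rewrite big1 ?mulr0 ?mul0r // => f _; rewrite mulr0.
Qed.

Lemma extd_near_eq n k (a b : dform R n k) u V :
  (\forall x \near u, forall W, a x W = b x W) -> extd a u V = extd b u V.
Proof.
move=> ab; apply: eq_bigr => i _; congr (_ * _); apply: near_eq_derive.
by apply: filterS ab => x ->.
Qed.

Lemma extd0 n k (u : 'rV[R]_n) V : extd (fun _ (_ : 'M[R]_(k, n)) => 0) u V = 0 :> R.
Proof. by rewrite /extd big1 // => i _; rewrite derive_cst mulr0. Qed.

Variables (A : form R 7 3) (U : set 'rV[R]_6) (phi : 'rV[R]_6 -> 'rV[R]_7).
Hypothesis Aa : alternating A.
Hypothesis phiP : parametrization U phi.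

Let B : form R 7 4 := flat_star (k := 3) (l := 4) (g34 R) A.
Let Ba : alternating B. Proof. exact: (@alternating_flat_star R 3 4). Qed.
Let AB : star_pair (k := 3) (l := 4) (g34 R) A B. Proof. exact: (@star_pair_flat_star R 3 4). Qed.
Let BA : star_pair (k := 4) (l := 3) (g34 R) B A.
Proof. by apply: star_pair_sym AB; [exact: g34_sym|exact: det_g34]. Qed.

Let U_open : open U. Proof. by case: phiP. Qed.
Let a : dform R 6 2 := fun x V => A (col_mx (phi x) (V *m 'J phi x) : 'M[R]_(1 + 2, 7)).
Let G := induced_metric phi.
Let eps := orientation phi.

Let star_a x : U x -> @star R 6 G 2 4 a x = (fun V => eps x * B (V *m 'J phi x)).
Proof.
move=> Ux; apply: (@hodgeE R 2 4).
exact: (hodge_contraction (g34_sym R) (det_g34 R) (param_unit phiP Ux)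
  (param_tangent phiP Ux) (param_free phiP Ux) Ba AB).
Qed.

Let extd_star_a x V : U x -> extd (@star R 6 G 2 4 a) x V = 0.
Proof.
move=> Ux; rewrite (@extd_near_eq _ _ _ (fun y (W : 'M[R]_(4, 6)) => eps x * B (W *m 'J phi y))).
  apply: (extd_pullback_const (A := fun W => eps x * B W) U_open (param_diff phiP)
    (param_diff2 phiP) (param_sym phiP)) => //.
  exact: alternatingZ.
apply: filterS2 (near_open U_open Ux) (orientation_near phiP Ux) => y Uy ey W.
have E := congr1 (fun f : form R 6 4 => f W) (star_a Uy).
apply: etrans E _.
by rewrite /eps ey.
Qed.

Let codiff_a x W : U x -> codiff G 4 a x W = 0.
Proof.
move=> Ux; rewrite /codiff /star.
have -> : extd (@star R 6 G 2 (6 - 2) a) x = (fun=> 0) by apply/funext => V; exact: extd_star_a.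
by rewrite [X in X W](@hodgeE R 5 1 _ _ _ (is_hodge0 _)) mulr0.
Qed.

Let extd_a x : U x -> extd a x = (fun V => 3 * A (V *m 'J phi x)).
Proof.
move=> Ux; apply/funext => V.
exact: (@extd_pullback_contraction R 6 7 U phi U_open (param_diff phiP)
  (param_diff2 phiP) (param_sym phiP) 2 A x V Aa Ux).
Qed.

Let star_extd_a x : U x -> @star R 6 G 3 3 (extd a) x =
  (fun V => 3 * (- eps x * B (col_mx (phi x) (V *m 'J phi x) : 'M[R]_(1 + 3, 7)))).
Proof.
move=> Ux; rewrite /star extd_a //; apply: (@hodgeE R 3 3); apply: is_hodgeZ.
exact: (hodge_restriction3 (g34_sym R) (det_g34 R) (param_unit phiP Ux)
  (param_tangent phiP Ux) (param_free phiP Ux) Ba AB).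
Qed.

Let extd_star_extd_a x : U x -> extd (@star R 6 G 3 3 (extd a)) x =
  (fun V => - 12 * eps x * B (V *m 'J phi x)).
Proof.
move=> Ux; apply/funext => V; pose C : form R 7 4 := fun W => 3 * (- eps x * B W).
have Ca : alternating C by do 2 apply: alternatingZ.
rewrite (@extd_near_eq _ _ _
  (fun y (W : 'M[R]_(3, 6)) => C (col_mx (phi y) (W *m 'J phi y) : 'M[R]_(1 + 3, 7)))).
  have E := @extd_pullback_contraction R 6 7 U phi U_open (param_diff phiP)
    (param_diff2 phiP) (param_sym phiP) 3 C x V Ca Ux.
  by apply: etrans E _; rewrite /C; ring.
apply: filterS2 (near_open U_open Ux) (orientation_near phiP Ux) => y Uy ey W.
have E := congr1 (fun f : form R 6 3 => f W) (star_extd_a Uy).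
apply: etrans E _.
by rewrite /C /eps ey.
Qed.

Let eps_sqr x : U x -> eps x * eps x = 1.
Proof.
move=> Ux; have := adapted_unitmx (param_unit phiP Ux) (param_tangent phiP Ux) (param_free phiP Ux).
by rewrite unitmxE unitfE /eps /orientation -expr2 sqr_sg => ->.
Qed.

(** The contraction is coclosed; the factor 12 is 3 * 4, from the differentials of
   two contracted forms, of degrees 3 and 4 before contraction. *)
Lemma laplacian_contraction u V : U u -> laplacian G 4 a u V = 12 * a u V.
Proof.
move=> Uu; rewrite /laplacian.
rewrite (@extd_near_eq _ _ _ (fun _ _ => 0)) ?extd0 ?add0r; last first.
  by apply: filterS (near_open U_open Uu) => x Ux W; exact: codiff_a.
rewrite /codiff /star extd_star_extd_a //.
rewrite [X in X V](@hodgeE R 4 2 _ _ (fun V => - 12 * eps u * (eps u * a u V))); last first.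
  apply: is_hodgeZ.
  exact: (hodge_restriction4 (g34_sym R) (det_g34 R) (param_unit phiP Uu)
    (param_tangent phiP Uu) (param_free phiP Uu) Aa BA).
(* The sign in the codifferential of a 3-form is (-1)^29. *)
rewrite -signr_odd /= expr1; set t := a u V.
rewrite (_ : -1 * _ = 12 * (eps u * eps u) * t); last by ring.
by rewrite eps_sqr // mulr1.
Qed.

End LaplacianOmega.

Theorem theorem4p9 (R : realType) : eigenform 12 (@omega R).
Proof.
split; first exact: omega_nonzero.
move=> U phi phiP u Uu V.
have -> : pullback phi (@omega R) =
    (fun x W => cayley3 (col_mx (phi x) (W *m 'J phi x) : 'M[R]_(1 + 2, 7))).
  by apply/funext => x; apply/funext => W; exact: omegaE.
rewrite (laplacian_contraction (@alternating_cayley3 R) phiP) //.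
by rewrite /pullback omegaE.
Qed.
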